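(* Let $c\in(\mathbb{C}\setminus\mathcal{M})_{<1}$, i.e. $c\notin\mathcal{M}$ and the Julia set $J_c$ of $f_c(z)=z^2+c$ has Hausdorff dimension strictly less than one. Let $T_1$ and $T_2$ be the two branches of $f_c^{-1}$ and let $z_1$ be the fixed point of $T_1$. Then $$z_1-(-z_1)=\sum_{w\in\{T_1,T_2\}^*}(-1)^{\eta}\Big(w(T_1(-z_1))-w(T_2(-z_1))\Big),$$ where $\eta$ is the number of $T_2$'s in the word $w$.
   Context: $\mathcal{M}$ is the Mandelbrot set and $J_c$ is the Julia set of $f_c(z)=z^2+c$, which is a Cantor set for $c\notin\mathcal{M}$. For $c\notin\mathcal{M}$ the two branches $T_1,T_2=-T_1$ of $f_c^{-1}$ are the two holomorphic inverse branches of $f_c$ on a closed topological disk $D\supset J_c$ bounded by an equipotential curve $\{G_c=s\}$ with $G_c(0)<s<G_c(c)$ ($G_c$ being the Green's function of the filled Julia set), so that $c\notin D$ and $f_c^{-1}(D)=T_1(D)\sqcup T_2(D)\subset D$; for real $c<-2$ they are $T_1(z)=\sqrt{z-c}$ and $T_2(z)=-\sqrt{z-c}$ on the real interval spanned by $J_c$. Each $T_i$ has a unique fixed point $z_i\in J_c$. $\{T_1,T_2\}^*$ is the set of all finite words in $T_1,T_2$, including the empty word, each word acting as the corresponding composition of maps. *)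

(* Defs.v *)
From HB Require Import structures.
From mathcomp Require Import all_boot all_order all_algebra.
From mathcomp Require Import complex finmap.
From mathcomp Require Import all_classical all_reals all_analysis.
From mathcomp Require Import showcase.summability.

Set Implicit Arguments.
Unset Strict Implicit.
Unset Printing Implicit Defensive.

Import Order.TTheory GRing.Theory Num.Theory.
Import numFieldNormedType.Exports Normc.

Local Open Scope classical_set_scope.
Local Open Scope ring_scope.

(* The complex plane is written R[i]^o rather than R[i]: the normed-module
   structure over R[i], hence the topology and [derivable], is inferred on
   the regular-algebra alias. Real-valued moduli are [normc]. *)

Section Hausdorff.
Context {R : realType}.
Local Open Scope ereal_scope.

Definition diam (U : set R[i]^o) : \bar R :=
  maxe 0 (ereal_sup [set (normc (p.1 - p.2)%R)%:E | p in U `*` U]).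

Definition hausdorff_pre (a delta : R) (A : set R[i]^o) : \bar R :=
  ereal_inf [set \sum_(0 <= i <oo) (diam (U i) `^ a)
            | U in [set U : nat -> set R[i]^o |
                     A `<=` \bigcup_i U i /\
                     forall i, diam (U i) <= delta%:E]].

Definition hausdorff_measure (a : R) (A : set R[i]^o) : \bar R :=
  ereal_sup [set hausdorff_pre a delta A | delta in [set d : R | (0 < d)%R]].

(* Restricting to a > 0 does not change the infimum, and avoids the
   convention 0 `^ 0 = 1. *)
Definition hausdorff_dim (A : set R[i]^o) : \bar R :=
  ereal_inf [set a%:E | a in [set a : R | (0 < a)%R /\
                                          hausdorff_measure a A = 0]].

End Hausdorff.

Section Dynamics.
Context {R : realType}.

Definition quad (c z : R[i]^o) : R[i]^o := z ^+ 2 + c.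

Definition filled_julia (c : R[i]^o) : set R[i]^o :=
  [set z | exists M : R, forall n, normc (iter n (quad c) z) <= M].

Definition julia (c : R[i]^o) : set R[i]^o :=
  closure (filled_julia c) `\` interior (filled_julia c).

Definition mandelbrot : set R[i]^o := [set c | filled_julia c 0].

(* Green's function of the filled Julia set with pole at infinity:
   lim 2^-n log^+ |f_c^n(z)|, where log^+ x = ln (max 1 x). *)
Definition green (c z : R[i]^o) : R :=
  lim ((fun n => ln (Num.max 1 (normc (iter n (quad c) z))) / 2 ^+ n) @ \oo).

(* For green c 0 < s, this is the closed topological disk bounded by the
   equipotential curve green c = s. *)
Definition green_disk (c : R[i]^o) (s : R) : set R[i]^o :=
  [set z | green c z <= s].

Definition inverse_branch (c : R[i]^o) (D : set R[i]^o)
    (T : R[i]^o -> R[i]^o) : Prop :=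
  [/\ {within D, continuous T},
      forall z, interior D z -> derivable T z 1
    & forall z, D z -> quad c (T z) = z].

(* Words in T1, T2 are encoded as bit sequences: false is the letter T1, true
   is the letter T2; [:: b1; ...; bn] acts as the composite
   T_b1 \o ... \o T_bn, and the empty word as the identity. *)
Definition word_act (T1 T2 : R[i]^o -> R[i]^o) (w : seq bool) (z : R[i]^o) :
    R[i]^o :=
  foldr (fun b x => if b then T2 x else T1 x) z w.

End Dynamics.

(* Main.v *)
Require Import Defs.
From mathcomp Require Import all_boot all_order all_algebra.
From mathcomp Require Import complex finmap.
From mathcomp Require Import all_classical all_reals all_analysis.
From mathcomp Require Import showcase.summability.
From mathcomp Require Import ring lra zify.

Import Order.TTheory GRing.Theory Num.Theory.
Import numFieldNormedType.Exports.
Import Normc.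

Set Implicit Arguments.
Unset Strict Implicit.
Unset Printing Implicit Defensive.

Local Open Scope classical_set_scope.
Local Open Scope ring_scope.

(** Why the identity holds. Write [f] for [quad c], [K] for the filled Julia set,
    [T false], [T true] for the branches [T1], [T2], and let the gap of a word [w]
    be the modulus of [w(z1) - w(-z1)]. Since [T1 z1 = z1] and [T2 z1 = -z1], the
    points [w(z1)], [w(T1(-z1))], [w(T2(-z1))], [w(-z1)] are, in this order, the
    ends of the gap of [w T1], of the summand of [w], and of the gap of [w T2],
    the last one traversed backwards. The sign of [w] absorbs the reversal, so the
    signed sum of the gaps of length [n] equals the sum of the summands of
    length [n] plus the signed sum of the gaps of length [n+1]
    ([signed_level_gap_rec]). Both the telescoping and the unconditional convergence
    then follow from one fact: the sum of all gaps is finite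
    ([sum_level_gap_bounded]).

    This is where dimension below one enters. It yields covers of the Julia set by
    finitely many discs of arbitrarily small total radius ([finite_ball_cover]). A
    connected set covered by such discs has diameter at most twice the total
    radius ([connected_ball_cover]), and this has two consequences. First, [K] has
    empty interior, because the boundary of a bounded open set projects onto an
    interval; so [K] is the Julia set ([julia_filled]). Second, let [E] be the set
    where the modulus of [f^N] is at most [r]. For suitable [N] and [r] it lies in
    the domain of the branches and contains the critical point, hence is connected
    ([level_set_in_green_disk], [connected_level_set]). The images [w(E)] are
    connected and, for long [w], close to [K], so their diameters tend to zero
    uniformly ([act_uniformly_small]).

    A maximum principle turns this into exponential contraction. With [n] the
    length of [w], the quotient of [x - y] by [w(x) - w(y)] is a polynomial in
    [w(x)], the difference quotient of [f^n]; a polynomial has no nonzero local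
    minimum of its modulus, so the minimum over [w(E)] is attained over the boundary
    of [E], which stays away from [y] in [K] ([act_lipschitz_diam],
    [act_contraction]). Contraction gives bounded distortion, because
    [T x - T y = (x - y) / (T x + T y)] and the denominators stay away from zero
    ([bounded_distortion]); in particular gaps are submultiplicative up to a
    constant ([gap_cat]). Bounded distortion also replaces the discs of a cover by
    cylinders [w(K)] of comparable size ([cylinder_hull]). Hence there is a finite
    set [W] of words, with total gap as small as needed, such that every long word
    begins with a word of [W]; summing over the rest of the word bounds the sum of
    all gaps by a finite sum plus half of itself. *)

(** * The plane and its modulus *)

Section ComplexPlane.
Context {R : realType}.
Local Notation C := (R[i]^o).
Implicit Types (x y z : C) (A B : set C).

Lemma norm_normc x : `|x| = (normc x)%:C%C.
Proof. by rewrite normc_def; case: x. Qed.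

Lemma normc_ge0 x : 0 <= normc x.
Proof. by case: x => a b /=; exact: sqrtr_ge0. Qed.

Lemma normc_eq0 x : (normc x == 0) = (x == 0).
Proof.
by apply/eqP/eqP => [/eq0_normc//|->]; exact: (normc0 R).
Qed.

Lemma normc_gt0 x : (0 < normc x) = (x != 0).
Proof. by rewrite lt0r normc_ge0 normc_eq0 andbT. Qed.

(** The triangle inequality is known for [Rcomplex R], an alias of [R[i]] with other
    canonical structures than [C]. *)
Lemma ler_normcD x y : normc (x + y) <= normc x + normc y.
Proof. exact: le_normcD. Qed.

Lemma normc_opp x : normc (- x) = normc x.
Proof. exact: normcN. Qed.

Lemma normc_distC x y : normc (x - y) = normc (y - x).
Proof. by rewrite -normc_opp opprB. Qed.

Lemma ler_normcB x y : normc (x - y) <= normc x + normc y.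
Proof. by rewrite -(normc_opp y); exact: ler_normcD. Qed.

Lemma normc_triangle z x y : normc (x - y) <= normc (x - z) + normc (z - y).
Proof. by rewrite -[x - y](subrKA z); exact: ler_normcD. Qed.

Lemma lerB_normc x y : normc x - normc y <= normc (x - y).
Proof. by rewrite lerBlDr; rewrite -{1}[x](subrK y); exact: ler_normcD. Qed.

Lemma lerB_normcD x y : normc x - normc y <= normc (x + y).
Proof. by rewrite -{2}[y]opprK -(normc_opp y); exact: lerB_normc. Qed.

Lemma normcX x n : normc (x ^+ n) = normc x ^+ n.
Proof.
by elim: n => [|n IH]; rewrite ?expr0 ?exprS ?normcM ?IH //; exact: normc1.
Qed.

(** Balls of [C] as a normed module over itself have complex radii; a positive complex
    number is real, so the real-valued modulus describes the same neighborhoods. *)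
Lemma nbhs_normcP x A :
  nbhs x A <-> exists2 e : R, 0 < e & forall y, normc (y - x) < e -> A y.
Proof.
split=> [/nbhs_ballP[e /= e0 eA]|[e e0 eA]].
  have er := RRe_real (gtr0_real e0).
  exists (complex.Re e); first by rewrite -ltcR er.
  move=> y xy; apply: eA; rewrite -ball_normE /ball_ /= norm_normc.
  by rewrite normc_distC -er ltcR.
apply/nbhs_ballP; exists (e%:C)%C => /=; first by rewrite ltcR.
by move=> y; rewrite -ball_normE /ball_ /= norm_normc ltcR normc_distC => /eA.
Qed.

Lemma closedN_normc A x : closed A -> ~ A x ->
  exists2 e : R, 0 < e & forall y, normc (y - x) < e -> ~ A y.
Proof.
by rewrite -openC openE => oA /oA /nbhs_normcP.
Qed.

Lemma continuous_normcP (f : C -> C) :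
  (forall x (e : R), 0 < e -> exists2 d : R, 0 < d &
     forall y, normc (y - x) < d -> normc (f y - f x) < e) <-> continuous f.
Proof.
split=> [H x A /nbhs_normcP[e e0 eA]|H x e e0].
  have [d d0 dE] := H x e e0.
  by apply/nbhs_normcP; exists d => // y /dE/eA.
have : nbhs (f x) [set z | normc (z - f x) < e] by apply/nbhs_normcP; exists e.
by move=> /H /nbhs_normcP.
Qed.

Lemma within_continuous_normcP (f : C -> C) A : {within A, continuous f} ->
  forall x, A x -> forall e : R, 0 < e -> exists2 d : R, 0 < d &
    forall y, A y -> normc (y - x) < d -> normc (f y - f x) < e.
Proof.
move=> cf x Ax e e0.
have : nbhs (f x) [set z | normc (z - f x) < e] by apply/nbhs_normcP; exists e.
move=> fS; have : nbhs (x : subspace A) (f @^-1` [set z | normc (z - f x) < e]).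
  exact: cf.
move=> /(nbhs_subspace_ex _ Ax)[V /nbhs_normcP[d d0 dV] UV].
exists d => // y Ay /dV Vy.
by have : (V `&` A) y by []; rewrite -UV => -[].
Qed.

Lemma normc_continuous : continuous (@normc R : C -> R).
Proof.
move=> x A /nbhs_ballP[e /= e0 eA]; apply/nbhs_normcP; exists e => // y xy.
apply: eA; rewrite /ball /= ltr_norml; apply/andP; split.
  rewrite ltrNl opprB; apply: le_lt_trans xy; exact: lerB_normc.
by apply: le_lt_trans xy; rewrite normc_distC; exact: lerB_normc.
Qed.

Lemma closed_normc_le (f : C -> C) (r : R) : continuous f ->
  closed [set z | normc (f z) <= r].
Proof.
move=> cf; apply: (@preimage_closed _ _ (fun z => normc (f z)) [set x | x <= r]).
  by move=> x _; apply: continuous_comp; [exact: cf|exact: normc_continuous].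
exact: closed_le.
Qed.

(** Heine-Borel is transported from the square of real and imaginary parts. *)
Lemma compact_disc (r : R) : compact [set z : C | normc z <= r].
Proof.
pose g (p : R * R) : C := (p.1 +i* p.2)%C.
pose Q := (`[- r, r] `*` `[- r, r])%classic : set (R * R).
have cg : continuous g.
  move=> p A /nbhs_normcP[e e0 eA].
  have e2 : 0 < e / 2 by lra.
  apply/nbhs_ballP; exists (e / 2) => // q [].
  rewrite /ball /= => h1 h2; apply: eA.
  have -> : g q - g p = ((q.1 - p.1) +i* 0)%C + (0 +i* (q.2 - p.2))%C.
    by rewrite /g; simpc.
  apply: le_lt_trans (ler_normcD _ _) _ => /=.
  rewrite !(expr0n, addr0, add0r) /= !sqrtr_sqr.
  by rewrite distrC in h1; rewrite distrC in h2; lra.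
apply: (@subclosed_compact _ _ (g @` Q)).
- by apply: (@closed_normc_le id) => x.
- apply: continuous_compact; first exact: continuous_subspaceT.
  by apply: compact_setX; exact: segment_compact.
- move=> [a b] /= nr; exists (a, b) => //=.
  have aux (u v : R) : Num.sqrt (u ^+ 2 + v ^+ 2) <= r -> u \in `[- r, r].
    move=> H; rewrite in_itv /= -ler_norml; apply: le_trans H.
    by rewrite -sqrtr_sqr ler_sqrt ?lerDl ?sqr_ge0 // addr_ge0 ?sqr_ge0.
  by split=> /=; [apply: aux nr|apply: (aux b a); rewrite addrC].
Qed.

Lemma connected_disc (r : R) : connected [set z : C | normc z <= r].
Proof.
have [r0|r0] := leP 0 r; last first.
  suff -> : [set z : C | normc z <= r] = set0 by exact: connected0.
  apply/seteqP; split=> // z /= ; have := normc_ge0 z; lra.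
pose seg (z : C) := (fun t : R => (t%:C)%C * z : C) @` `[0, 1]%classic.
have cseg z : connected (seg z).
  apply: connected_continuous_connected; first exact: segment_connected.
  apply: continuous_subspaceT => t A /nbhs_normcP[e e0 eA].
  have z1 : 0 < normc z + 1 by rewrite ltr_wpDl // normc_ge0.
  apply/nbhs_ballP; exists (e / (normc z + 1)); first exact: divr_gt0.
  move=> u; rewrite /ball /= distrC ltr_pdivlMr // => ut; apply: eA.
  rewrite -mulrBl -rmorphB /= normcM /= expr0n /= addr0 sqrtr_sqr.
  apply: le_lt_trans ut; apply: ler_wpM2l => //; lra.
suff -> : [set z : C | normc z <= r] = \bigcup_(z in [set z | normc z <= r]) seg z.
  apply: bigcup_connected => //; exists 0 => z _; exists 0.
    by rewrite /= in_itv /= lexx ler01.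
  by rewrite mul0r.
apply/seteqP; split=> [z zr|_ [z zr [t /= + <-]]].
  by exists z => //; exists 1; rewrite ?mul1r //= in_itv /= ler01 lexx.
rewrite in_itv /= => /andP[t0 t1].
rewrite normcM /= expr0n /= addr0 sqrtr_sqr ger0_norm //.
apply: le_trans zr; apply: ler_piMl => //; exact: normc_ge0.
Qed.

(** Compactness for increasing sequences of sets. It serves both to extract finite
    subcovers and, with complements, as Cantor's intersection theorem. *)
Lemma compact_exhaust A (P : nat -> set C) : compact A ->
  (forall n m, (n <= m)%N -> P n `<=` P m) ->
  (forall x, A x -> exists n, exists2 e : R, 0 < e &
     forall y, normc (y - x) < e -> P n y) ->
  exists n, A `<=` P n.
Proof.
move=> /compact_near_coveringP cA mP H.
have : \forall n \near \oo, A `<=` P n.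
  apply: cA => x Ax; have [n [e e0 eP]] := H x Ax.
  exists ([set y | normc (y - x) < e], [set m | (n <= m)%N]) => /=.
    by split; [apply/nbhs_normcP; exists e|exists n].
  by move=> [y m] /= [/eP yn nm]; exact: mP nm _ yn.
by move=> [n _ /(_ n (leqnn n)) ?]; exists n.
Qed.

Lemma compact_closed_dist A B : compact A -> closed B ->
  (forall x, A x -> ~ B x) ->
  exists2 d : R, 0 < d & forall x y, A x -> B y -> d <= normc (x - y).
Proof.
move=> cA cB AB.
pose P n : set C := [set x | forall y, B y -> n.+1%:R^-1 <= normc (x - y)].
have [n nA] : exists n, A `<=` P n.
  apply: compact_exhaust cA _ _ => [n m nm x Px y /Px|x Ax].
    by apply: le_trans; rewrite lef_pV2 ?posrE ?ltr0n // ler_nat.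
  have [e e0 eB] := closedN_normc cB (AB _ Ax).
  have e2 : 0 < e / 2 by lra.
  have [n nE] := ltr_add_invr (e2 : 0 < e / 2).
  rewrite add0r in nE.
  exists n; exists (e / 2) => // y yx z Bz.
  rewrite leNgt; apply/negP => yz; apply: (eB z) => //.
  have := normc_triangle y z x; rewrite (normc_distC z y).
  by move: nE yz yx; set u := (_^-1); lra.
by exists (n.+1%:R^-1) => [|x y /nA H /H //]; rewrite invr_gt0 ltr0n.
Qed.

Lemma connected_closed_cover A B1 B2 : connected A -> closed B1 -> closed B2 ->
  A `<=` B1 `|` B2 -> (forall z, A z -> B1 z -> ~ B2 z) -> A `&` B1 !=set0 ->
  A `<=` B1.
Proof.
move=> cA c1 c2 AB B12 AB1.
suff <- : A `&` B1 = A by move=> z [].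
apply: cA => //; last by exists B1.
exists (~` B2); first by rewrite openC.
apply/seteqP; split=> z [Az Bz]; split => //; first exact: B12 Bz.
by case: (AB z Az).
Qed.

Lemma compact_closed_plane A : compact A -> closed A.
Proof. by apply: compact_closed; exact: norm_hausdorff. Qed.

End ComplexPlane.

(** * Iteration of a quadratic polynomial *)

Section QuadraticDynamics.
Context {R : realType}.
Local Notation C := (R[i]^o).
Variable c : C.
Implicit Types (z : C).
Local Notation f := (quad c).

Lemma quadN z : f (- z) = f z.
Proof. by rewrite /quad sqrrN. Qed.

Lemma quadB z y : f z - f y = (z - y) * (z + y).
Proof. by rewrite /quad opprD addrACA subrr addr0 subr_sqr. Qed.

Lemma quad_eq z y : f z = f y -> z = y \/ z = - y.
Proof.
move/eqP; rewrite -subr_eq0 quadB mulf_eq0 subr_eq0 addr_eq0.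
by case/orP=> /eqP; [left|right].
Qed.

Lemma quad_surj z : exists y, f y = z.
Proof. by exists (sqrtc (z - c)); rewrite /quad sqr_sqrtc subrK. Qed.

Lemma quad0 : f 0 = c.
Proof. by rewrite /quad expr0n add0r. Qed.

Lemma quad_continuous : continuous f.
Proof.
apply/continuous_normcP => x e e0.
have n1 : 0 < 2 * normc x + 1 by have := normc_ge0 x; lra.
exists (Num.min 1 (e / (2 * normc x + 1))).
  by rewrite lt_min ltr01 divr_gt0.
move=> y; rewrite lt_min => /andP[y1]; rewrite ltr_pdivlMr // => ye.
rewrite quadB normcM; apply: le_lt_trans ye.
apply: ler_wpM2l; first exact: normc_ge0.
have -> : y + x = (y - x) + x *+ 2 by rewrite mulr2n; ring.
apply: le_trans (ler_normcD _ _) _; rewrite normcMn.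
by rewrite mulr_natl addrC lerD2l ltW.
Qed.

Lemma iter_quad_continuous n : continuous (iter n f).
Proof.
elim: n => [|n IH] z /=; first by [].
apply: (@continuous_comp _ _ _ (iter n f) f); first exact: IH.
exact: quad_continuous.
Qed.

Lemma quad_escape z : 2 + normc c < normc z -> 2 * normc z <= normc (f z).
Proof.
move=> zc; have c0 := normc_ge0 c.
apply: le_trans (lerB_normcD _ _); rewrite normcX.
have : 0 <= (normc z - (2 + normc c)) * normc z by apply: mulr_ge0; lra.
have : 0 <= normc c * (normc z - 1) by apply: mulr_ge0; lra.
by rewrite expr2; nra.
Qed.

Lemma iter_quad_escape n z : 2 + normc c < normc z ->
  2 ^+ n * normc z <= normc (iter n f z).
Proof.
move=> zc; have c0 := normc_ge0 c; elim: n => [|n IH]; first by rewrite mul1r.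
have n1 : 1 <= 2 ^+ n :> R by rewrite exprn_ege1 // ler1n.
have zn : 2 + normc c < normc (iter n f z).
  apply: lt_le_trans zc _; apply: le_trans IH.
  by apply: ler_peMl => //; exact: normc_ge0.
rewrite exprS -mulrA iterS; apply: le_trans (quad_escape zn).
by apply: ler_wpM2l.
Qed.

(** These sets take the place of the sublevel sets of the Green function: they
    exhaust the same region, and they are iterated preimages of a round disc. *)
Definition level_set n (r : R) : set C := [set z | normc (iter n f z) <= r].

Variable r : R.
Hypothesis rc : 2 + normc c <= r.

Lemma level_setSr n z : level_set n.+1 r z = level_set n r (f z).
Proof. by rewrite /level_set /= -iterSr. Qed.

Lemma sub_level_set n m : (n <= m)%N -> level_set m r `<=` level_set n r.
Proof.
move=> /subnKC <-; elim: (m - n)%N => [|k IH]; rewrite ?addn0 //.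
rewrite addnS => z /= zk; apply: IH; rewrite /level_set /=.
have [//|lt] := leP (normc (iter (n + k) f z)) r.
have := quad_escape (le_lt_trans rc lt); move: zk (normc_ge0 c) rc.
by rewrite /level_set /=; lra.
Qed.

Lemma compact_level_set n : compact (level_set n r).
Proof.
apply: (@subclosed_compact C _ [set z : C | normc z <= r]).
- exact/closed_normc_le/iter_quad_continuous.
- exact: compact_disc.
- exact: (@sub_level_set 0 n).
Qed.

(** The squaring cover cannot split over a connected set that contains the critical
    value. Suppose the preimage is the disjoint union of closed sets [B1] and [B2],
    with the critical point in [B1]. Every point of [A] has either both its
    preimages in [B1] or one in [B2]; these alternatives exclude each other and are
    both closed, and the first one holds at [c], so it holds on all of [A]. *)
Lemma connected_preimage_quad (A : set C) : compact A -> connected A -> A c ->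
  compact (f @^-1` A) -> connected (f @^-1` A).
Proof.
move=> kA cA Ac kfA B [b Bb] [U oU BU] [F cF BF].
have cfA := compact_closed_plane kfA.
have key (B1 B2 : set C) : closed B1 -> closed B2 -> B1 `|` B2 = f @^-1` A ->
    (forall z, B1 z -> ~ B2 z) -> B1 0 -> f @^-1` A `<=` B1.
  move=> c1 c2 B12 dB B10.
  have cmp D : closed D -> D `<=` f @^-1` A -> closed (f @` D).
    move=> cD sD; apply: compact_closed_plane; apply: continuous_compact.
      by apply: continuous_subspaceT => z; exact: quad_continuous.
    exact: subclosed_compact kfA sD.
  have cN1 : closed [set z | B1 (- z)].
    apply: (@preimage_closed _ _ (fun z : C => - z)) c1 => z _.
    exact: opp_continuous.
  have AB : A `<=` f @` (B1 `&` [set z | B1 (- z)]).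
    apply: (@connected_closed_cover _ _ _ (f @` B2)) => //.
    - apply: cmp; first exact: closedI.
      by move=> z [B1z _]; rewrite -B12; left.
    - by apply: cmp => // z; rewrite -B12; right.
    - move=> z Az; have [y yz] := quad_surj z.
      have [By|B2y] : (B1 `|` B2) y by rewrite B12 /= yz.
        have [By'|B2y] : (B1 `|` B2) (- y) by rewrite B12 /= quadN yz.
          by left; exists y.
        by right; exists (- y) => //; rewrite quadN.
      by right; exists y.
    - move=> _ _ [z [Bz BNz] <-] [y B2y /quad_eq[yz|yz]].
        by rewrite yz in B2y; exact: dB B2y.
      by rewrite yz in B2y; exact: dB B2y.
    - exists c; split=> //; exists 0; last exact: quad0.
      by rewrite /= oppr0.
  move=> z /AB[y [By BNy] /quad_eq[<-//|yz]].
  by rewrite -[z]opprK -yz.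
set B' := f @^-1` A `\` B.
have cB : closed B by rewrite BF; exact: closedI.
have cB' : closed B'.
  rewrite (_ : B' = f @^-1` A `&` ~` U).
    by apply: closedI => //; exact: open_closedC.
  rewrite /B' BU; apply/seteqP; split=> z [Az] nz; split => //.
    by move=> Uz; apply: nz.
  by move=> [].
have sB : B `<=` f @^-1` A by rewrite BF => z [].
have BB' : B `|` B' = f @^-1` A by rewrite setDUK.
apply/seteqP; split=> //.
have [B0|B0] := pselect (B 0).
  by apply: (key B B') => // z Bz [].
have := key B' B cB' cB; rewrite setUC => /(_ BB') key'.
have /(_ b (sB _ Bb))[] // : f @^-1` A `<=` B'.
apply: key' => [z []//|]; split => //.
by rewrite /= quad0.
Qed.

(** By [connected_preimage_quad], pulling back the disc [n] times keeps it connected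
    as long as the critical value lies in each of the sets being pulled back, that is,
    as long as the critical orbit stays in the disc. *)
Lemma connected_level_set n : level_set n r 0 -> connected (level_set n r).
Proof.
elim: n => [|n IH] n0; first exact: connected_disc.
have -> : level_set n.+1 r = f @^-1` level_set n r.
  by apply/seteqP; split=> z; rewrite level_setSr.
apply: connected_preimage_quad.
- exact: compact_level_set.
- exact/IH/(sub_level_set (leqnSn n)).
- by move: n0; rewrite level_setSr quad0.
- suff -> : f @^-1` level_set n r = level_set n.+1 r by exact: compact_level_set.
  by apply/seteqP; split=> z; rewrite level_setSr.
Qed.

(** An orbit that ever leaves the disc of radius [r] doubles its modulus from then on. *)
Lemma filled_juliaE z : filled_julia c z <-> forall n, level_set n r z.
Proof.
split=> [[M zM] n|H]; last by exists r.
rewrite /level_set /= leNgt; apply/negP => rn.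
have c0 := normc_ge0 c.
have rn' := le_lt_trans rc rn.
have [m mM] : exists m : nat, M < m%:R.
  exists (Num.bound `|M|).
  exact: le_lt_trans (ler_norm M) (archi_boundP (normr_ge0 M)).
have := zM (m + n)%N; rewrite iterD => /(le_trans (iter_quad_escape m rn')).
apply/negP; rewrite -ltNge; apply: lt_le_trans mM _.
have m2 : m%:R <= 2 ^+ m :> R by rewrite -natrX ler_nat ltnW // ltn_expl.
apply: le_trans m2 _; apply: ler_peMr; last lra.
by rewrite exprn_ge0.
Qed.

Lemma compact_filled_julia : compact (filled_julia c).
Proof.
apply: (@subclosed_compact _ _ (level_set 0 r)).
- rewrite (_ : filled_julia c = \bigcap_(n in setT) level_set n r).
    apply: closed_bigI => n _; exact/closed_normc_le/iter_quad_continuous.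
  apply/seteqP; split=> z; first by move=> /filled_juliaE H n _.
  by move=> H; apply/filled_juliaE => n; exact: H.
- exact: compact_level_set.
- by move=> z /filled_juliaE.
Qed.

Lemma filled_julia_preimage z : filled_julia c (f z) -> filled_julia c z.
Proof.
move=> /filled_juliaE H; apply/filled_juliaE => n.
by apply: (@sub_level_set n n.+1 (leqnSn n)); rewrite level_setSr.
Qed.

(** The filled Julia set is the decreasing intersection of the compact level sets. *)
Lemma level_set_in_open (V : set C) : open V -> filled_julia c `<=` V ->
  exists n, level_set n r `<=` V.
Proof.
move=> oV KV.
have [n nV] : exists n, level_set 0 r `<=` V `|` ~` level_set n r.
  apply: compact_exhaust; first exact: compact_level_set.
    move=> n m nm z [Vz|nz]; [by left|right=> mz].
    exact/nz/(sub_level_set nm).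
  move=> z _; have [Kz|] := pselect (filled_julia c z).
    exists 0%N; move: oV; rewrite openE => /(_ z (KV _ Kz)) /nbhs_normcP[e e0 eV].
    by exists e => // y /eV; left.
  move=> nKz; have [n nz] : exists n, ~ level_set n r z.
    by apply/existsNP => H; apply: nKz; exact/filled_juliaE.
  exists n; have cn : closed (level_set n r).
    exact/closed_normc_le/iter_quad_continuous.
  by have [e e0 eN] := closedN_normc cn nz; exists e => // y /eN; right.
exists n => z zn; have [//|/(_ zn)//] := nV z (sub_level_set (leq0n n) zn).
Qed.

End QuadraticDynamics.

(** * Approximating the Green function *)

Section GreenFunction.
Context {R : realType}.
Local Notation C := (R[i]^o).
Variable c : C.
Implicit Types (z : C).
Local Notation f := (quad c).

Let u z n : R := ln (Num.max 1 (normc (iter n f z))) / 2 ^+ n.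
Let L : R := ln (1 + normc c).

(** The logarithmic height doubles under [f] up to a bounded error, since [1 + |c|]
    compares the square of [max 1 |z|] with [max 1 |f z|] in both directions.
    Dividing by powers of two makes the errors summable. *)
Lemma log_height_quad z :
  `|ln (Num.max 1 (normc (f z))) - 2 * ln (Num.max 1 (normc z))|
    <= ln (1 + normc c).
Proof.
have c0 := normc_ge0 c; have z0 := normc_ge0 z.
set a := Num.max 1 (normc z); set b := Num.max 1 (normc (f z)).
have a1 : 1 <= a by rewrite le_max lexx.
have b1 : 1 <= b by rewrite le_max lexx.
have za : normc z <= a by rewrite le_max lexx orbT.
have fb : normc (f z) <= b by rewrite le_max lexx orbT.
have a0 : 0 < a by exact: lt_le_trans a1.
have b0 : 0 < b by exact: lt_le_trans b1.
have d0 : 0 < 1 + normc c by lra.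
have -> : 2 * ln a = ln (a ^+ 2) by rewrite lnXn // mulr_natl.
have a20 : 0 < a ^+ 2 by rewrite exprn_gt0.
have a21 : 1 <= a ^+ 2 by rewrite exprn_ege1.
have ca : 0 <= normc c * (a ^+ 2 - 1) by rewrite mulr_ge0 // subr_ge0.
have cb : 0 <= normc c * (b - 1) by rewrite mulr_ge0 // subr_ge0.
have ba : b <= (1 + normc c) * a ^+ 2.
  rewrite /b ge_max; apply/andP; split.
    lra.
  apply: le_trans (ler_normcD _ _) _; rewrite normcX.
  have : normc z ^+ 2 <= a ^+ 2 by rewrite lerXn2r // nnegrE // ltW.
  lra.
have ab : a ^+ 2 <= (1 + normc c) * b.
  have [z1|z1] := leP (normc z) 1.
    have -> : a = 1 by apply/max_idPl.
    by rewrite expr1n; lra.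
  have -> : a = normc z by apply/max_idPr/ltW.
  rewrite -normcX -[z ^+ 2](addrK c); apply: le_trans (ler_normcB _ _) _.
  by apply: le_trans (lerD fb (lexx _)) _; lra.
rewrite ler_distl; apply/andP; split.
  by rewrite lerBlDl -lnM ?posrE // ler_ln ?posrE // mulr_gt0.
by rewrite addrC -lnM ?posrE // ler_ln ?posrE // mulr_gt0.
Qed.

Let uS z n : `|u z n.+1 - u z n| <= L / 2 ^+ n.+1.
Proof.
have p0 : 0 < 2 ^+ n.+1 :> R by rewrite exprn_gt0.
have -> : u z n.+1 - u z n = (ln (Num.max 1 (normc (f (iter n f z))))
    - 2 * ln (Num.max 1 (normc (iter n f z)))) / 2 ^+ n.+1.
  rewrite /u iterS mulrBl; congr (_ - _).
  by rewrite exprS invfM mulrACA divff ?mul1r // pnatr_eq0.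
rewrite normrM [X in _ * X]gtr0_norm ?invr_gt0 //.
by rewrite ler_pM2r ?invr_gt0 //; exact: log_height_quad.
Qed.

Let LS n : L / 2 ^+ n = L / 2 ^+ n.+1 + L / 2 ^+ n.+1.
Proof.
rewrite exprS invfM mulrA -mulrDl; congr (_ * _).
by rewrite -[LHS]mulr1 -mulrDr; congr (_ * _); lra.
Qed.

Let L0 : 0 <= L.
Proof. by apply: ln_ge0; have := normc_ge0 c; lra. Qed.

Let upper z : {homo (fun n => u z n + L / 2 ^+ n) : n m / (n <= m)%N >-> m <= n}.
Proof.
apply/nonincreasing_seqP => n.
have := uS z n; rewrite ler_norml => /andP[_].
by rewrite (LS n); lra.
Qed.

Let lower z : {homo (fun n => u z n - L / 2 ^+ n) : n m / (n <= m)%N >-> n <= m}.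
Proof.
apply/nondecreasing_seqP => n.
have := uS z n; rewrite ler_norml => /andP[+ _].
by rewrite (LS n); lra.
Qed.

Let cvgL : (fun n => L / 2 ^+ n) @ \oo --> (0 : R).
Proof.
rewrite -(mulr0 L); apply: cvgMr.
under eq_fun do rewrite -exprVn.
by apply: cvg_expr; rewrite ger0_norm; lra.
Qed.

Lemma green_cvg z : u z @ \oo --> green c z.
Proof.
suff : cvgn (u z) by [].
(* Adding or subtracting [L / 2^n] makes the approximations monotone. *)
have ca : cvgn (fun n => u z n + L / 2 ^+ n).
  apply: nonincreasing_is_cvgn; first exact: upper.
  exists (u z 0 - L) => _ [n _ <-].
  have := lower z (leq0n n); rewrite expr0 divr1.
  have : 0 <= L / 2 ^+ n by rewrite divr_ge0 // exprn_ge0.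
  lra.
have -> : u z = (fun n => (u z n + L / 2 ^+ n) - L / 2 ^+ n).
  by apply/funext => n; rewrite addrK.
apply: is_cvgB => //; exact: (cvgP 0).
Qed.

Lemma green_le n z : green c z <= u z n + L / 2 ^+ n.
Proof.
have cv : (fun n => u z n + L / 2 ^+ n) @ \oo --> green c z.
  by rewrite -[green c z]addr0; apply: cvgD => //; exact: green_cvg.
rewrite -(cvg_lim _ cv) //.
by apply: nonincreasing_cvgn_ge; [exact: upper|exact: cvgP cv].
Qed.

Lemma green_ge n z : u z n - L / 2 ^+ n <= green c z.
Proof.
have cv : (fun n => u z n - L / 2 ^+ n) @ \oo --> green c z.
  by rewrite -[green c z]subr0; apply: cvgB => //; exact: green_cvg.
rewrite -(cvg_lim _ cv) //.
by apply: nondecreasing_cvgn_le; [exact: lower|exact: cvgP cv].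
Qed.

Lemma green_ge0 z : 0 <= green c z.
Proof.
rewrite -(cvg_lim _ (@green_cvg z)) //; apply: limr_ge.
  exact: cvgP (@green_cvg z).
apply: nearW => n; rewrite divr_ge0 ?exprn_ge0 // ln_ge0 //.
by rewrite le_max lexx.
Qed.

(** With [s'] strictly between the Green function at the critical point and [s], the
    radius [exp (2^n s')] works for large [n]: the level set is then
    defined by comparing the [n]-th approximation of the Green function with [s'],
    and this approximation has an error that tends to zero uniformly. *)
Lemma level_set_in_green_disk s : green c 0 < s ->
  exists n r, [/\ 2 + normc c < r, level_set c n r 0 &
                  level_set c n r `<=` green_disk c s].
Proof.
move=> G0s; have G0 := green_ge0 0; have c0 := normc_ge0 c.
pose s' := (green c 0 + s) / 2; pose h := (s - green c 0) / 2.
have s'0 : 0 < s' by rewrite /s'; lra.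
have h0 : 0 < h by rewrite /h; lra.
have [n [nL nc]] : exists n, L / 2 ^+ n <= h /\ ln (3 + normc c) <= 2 ^+ n * s'.
  pose M := L / h + ln (3 + normc c) / s'.
  have LH0 : 0 <= L / h by rewrite divr_ge0 // ltW.
  have lc0 : 0 <= ln (3 + normc c) / s' by rewrite divr_ge0 ?ln_ge0 ?ltW //; lra.
  have M0 : 0 <= M by exact: addr_ge0.
  exists (Num.bound M).
  have Mn : M <= 2 ^+ Num.bound M.
    apply: le_trans (ltW (archi_boundP M0)) _.
    by rewrite -natrX ler_nat ltnW // ltn_expl.
  rewrite ler_pdivrMr ?exprn_gt0 // -ler_pdivrMl // -ler_pdivrMr //.
  by split; apply: le_trans Mn; rewrite /M; lra.
pose r := expR (2 ^+ n * s').
have p0 : 0 < 2 ^+ n :> R by rewrite exprn_gt0.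
have r0 : 0 < r by exact: expR_gt0.
(* The bound on [n] was stated with 3 to make the radius exceed [2 + |c|] strictly. *)
have rc : 3 + normc c <= r.
  by rewrite -ler_ln ?posrE ?expRK //; lra.
have unE z : u z n <= s' <-> level_set c n r z.
  rewrite /u ler_pdivrMr // mulrC /level_set /=.
  have m0 : 0 < Num.max 1 (normc (iter n f z)) by rewrite lt_max ltr01.
  rewrite -[2 ^+ n * s']expRK -/r ler_ln ?posrE // ge_max.
  by split=> [/andP[]//|->]; rewrite andbT; lra.
exists n, r; split; first lra.
  by apply/unE; have := green_ge n 0; rewrite /s' /h in nL *; lra.
move=> z /unE zs; rewrite /green_disk /=; apply: le_trans (green_le n z) _.
by rewrite /s' in zs; rewrite /h in nL; lra.
Qed.

End GreenFunction.

(** * The modulus of a polynomial has no local minimum *)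

Section PolynomialModulus.
Context {R : realType}.
Local Notation C := (R[i]^o).
Implicit Types (p q s : {poly R[i]}) (z : C).

Lemma horner_continuous p : continuous (fun z : C => p.[z] : C).
Proof.
elim/poly_ind: p => [|p a IH].
  rewrite (_ : (fun _ => _) = (fun=> 0)); last first.
    by apply/funext => z; rewrite horner0.
  by move=> z; exact: cst_continuous.
rewrite (_ : (fun _ => _) = (fun z : C => (p.[z] : C) * z + (a : C))); last first.
  by apply/funext => z; rewrite hornerMXaddC.
move=> z; apply: (@continuousD _ C C (fun z : C => (p.[z] : C) * z)).
  apply: (@continuousM _ C (fun z : C => p.[z] : C)); first exact: IH.
  exact: cvg_id.
exact: cst_continuous.
Qed.

(** The step of d'Alembert and Argand in the fundamental theorem of algebra. Around
    [z0], write [q] as [q(z0) + s(h) h^m] with [s(0)] nonzero; a small positive multiple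
    of an [m]-th root [b] of [- q(z0) / s(0)] moves the value towards zero. A root of [q]
    rules out constant polynomials. *)
Lemma poly_no_local_min q z0 (d : R) : q.[z0] != 0 -> (exists a, root q a) ->
  0 < d -> exists2 z, normc (z - z0) < d & normc q.[z] < normc q.[z0].
Proof.
move=> q0 [a qa] d0.
pose p := q \Po ('X + z0%:P).
have pE h : p.[h] = q.[h + z0] by rewrite horner_comp !hornerE.
have p0E : p.[0] = q.[z0] by rewrite pE add0r.
have pn : p - p.[0]%:P != 0.
  rewrite subr_eq0; apply/eqP => /(congr1 (fun g : {poly R[i]} => g.[a - z0])).
  rewrite /= hornerC p0E (pE (a - z0)) subrK => qz; move: q0; rewrite -qz.
  by rewrite (rootP qa) eqxx.
have [m [s]] := multiplicity_XsubC (p - p.[0]%:P) 0.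
rewrite pn /= rootE subr0 => s0 ps.
have {}pE h : p.[h] = p.[0] + s.[h] * h ^+ m.
  have /= := congr1 (fun g : {poly R[i]} => g.[h]) ps.
  by rewrite !hornerE => /eqP; rewrite subr_eq addrC => /eqP.
have m0 : (0 < m)%N.
  rewrite lt0n; apply/eqP => m0; move: (pE 0); rewrite m0 expr0 mulr1.
  by move/eqP; rewrite -subr_eq0 opprD addrA subrr sub0r oppr_eq0 (negbTE s0).
pose b : R[i] := m.-root (- p.[0] / s.[0]).
have bm : b ^+ m = - p.[0] / s.[0] by rewrite rootCK.
have s0' : 0 < normc (s.[0] : C) by rewrite normc_gt0.
have [e e0 es] := (continuous_normcP _).2 (@horner_continuous s) 0 _ s0'.
have b0 := normc_ge0 (b : C).
(* Halving the minimum makes the three inequalities on [t] strict. *)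
pose t : R := Num.min 1 (Num.min (e / (normc b + 1)) (d / (normc b + 1))) / 2.
have b1 : 0 < normc b + 1 by lra.
have M0 : 0 < Num.min (e / (normc b + 1)) (d / (normc b + 1)).
  by rewrite lt_min !divr_gt0.
have t0 : 0 < t by rewrite divr_gt0 // lt_min ltr01.
have [t1 te td] : [/\ t < 1, t * normc b < e & t * normc b < d].
  have tm : t < Num.min 1 (Num.min (e / (normc b + 1)) (d / (normc b + 1))).
    rewrite /t; move: t0; rewrite /t; lra.
  move: tm; rewrite !lt_min !ltr_pdivlMr // => /and3P[-> h1 h2].
  by split=> //; lra.
have nt : normc (t%:C%C : C) = t.
  by rewrite /= expr0n /= addr0 sqrtr_sqr gtr0_norm.
pose h : C := (t%:C)%C * b.
have nh : normc h = t * normc b by rewrite /h normcM nt.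
exists (h + z0); first by rewrite addrK nh.
have pz : 0 < normc (p.[0] : C) by rewrite normc_gt0 p0E.
have -> : q.[h + z0] = p.[h] by rewrite horner_comp !hornerE.
rewrite -p0E.
have -> : p.[h] = p.[0] * (1 - (t ^+ m)%:C%C) +
    (t ^+ m)%:C%C * (p.[0] / s.[0]) * (s.[0] - s.[h]).
  rewrite pE /h exprMn bm rmorphXn /=; field; exact: s0.
apply: le_lt_trans (ler_normcD _ _) _.
rewrite !normcM normcV.
have tm0 : 0 < t ^+ m by rewrite exprn_gt0.
have tm1 : t ^+ m <= 1 by rewrite exprn_ile1 // ltW.
have -> : normc (1 - (t ^+ m)%:C)%C = 1 - t ^+ m.
  rewrite -[1]/(1%:C%C) -rmorphB /= expr0n /= addr0 sqrtr_sqr ger0_norm //; lra.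
have -> : normc ((t ^+ m)%:C)%C = t ^+ m.
  by rewrite /= expr0n /= addr0 sqrtr_sqr gtr0_norm.
have sh : normc (s.[0] - s.[h]) < normc s.[0].
  by rewrite normc_distC; apply: es; rewrite subr0 nh.
suff : t ^+ m * (normc p.[0] / normc s.[0]) * normc (s.[0] - s.[h]) <
       t ^+ m * normc p.[0] by lra.
rewrite -!mulrA ltr_pM2l // -[X in _ < X]mulr1 ltr_pM2l //.
by rewrite mulrC ltr_pdivrMr // mul1r.
Qed.

Lemma normc_poly_min q (A : set C) : A !=set0 -> compact A ->
  exists2 z, A z & forall y, A y -> normc q.[z] <= normc q.[y].
Proof.
move=> A0 cA.
have cq : {within A, continuous (fun z : C => normc q.[z])}.
  apply: continuous_subspaceT => z.
  apply: (@continuous_comp _ _ _ (fun z : C => q.[z] : C)).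
    exact: horner_continuous.
  exact: normc_continuous.
have [z /set_mem Az zm] := compact_EVT_min A0 cA cq.
by exists z => // y /mem_set/zm.
Qed.

End PolynomialModulus.

(** * Covers of small total radius *)

Section SmallCovers.
Context {R : realType}.
Local Notation C := (R[i]^o).
Implicit Types (A : set C).

(** Some exponent [a < 1] has measure zero. For sets of diameter at most one, the
    diameter is bounded by its [a]-th power. *)
Lemma hausdorff_dim_lt1_cover A (e : R) : (hausdorff_dim A < 1)%E -> 0 < e ->
  exists (U : nat -> set C) (rho : nat -> R),
    [/\ A `<=` \bigcup_i U i,
        forall i, 0 <= rho i,
        forall i x y, U i x -> U i y -> normc (x - y) <= rho i
      & forall n, \sum_(0 <= i < n) rho i <= e].
Proof.
move=> /ereal_inf_lt[_ [a [a0 Ha] <-]]; rewrite lte_fin => a1 e0.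
have : (hausdorff_pre a 1 A <= 0)%E.
  by rewrite -Ha; apply: ereal_sup_ubound; exists 1 => //=.
move=> pre0; have : (hausdorff_pre a 1 A < e%:E)%E.
  by apply: le_lt_trans pre0 _; rewrite lte_fin.
move=> /ereal_inf_lt[_ [U [AU dU] <-] sU].
have d0 i : (0 <= diam (U i))%E by rewrite /diam le_max lexx.
have dfin i : diam (U i) \is a fin_num.
  by rewrite ge0_fin_numE //; exact: le_lt_trans (dU i) (ltry _).
exists U, (fun i => fine (diam (U i))); split=> //.
- by move=> i; exact: fine_ge0.
- move=> i x y Ux Uy; rewrite -lee_fin fineK // /diam le_max.
  by apply/orP; right; apply: ereal_sup_ubound; exists (x, y).
- move=> n; rewrite -lee_fin -sumEFin.
  apply: le_trans (ltW sU).
  apply: (@le_trans _ _ (\sum_(0 <= i < n) diam (U i) `^ a)%E); last first.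
    by apply: nneseries_lim_ge => i _ _; exact: poweR_ge0.
  apply: lee_sum => i _; rewrite -[X in (_ <= X `^ _)%E]fineK // poweR_EFin lee_fin.
  have := fine_ge0 (d0 i); have : fine (diam (U i)) <= 1.
    by rewrite -lee_fin fineK.
  set t := fine _ => t1; rewrite le_eqVlt => /orP[/eqP<-|t0].
    exact: powR_ge0.
  rewrite -{1}(powRr1 (ltW t0)); apply: ger_powR; last exact: ltW.
  by rewrite t0.
Qed.

Definition ball_cover A (s : seq (C * R)) :=
  forall z, A z -> exists2 q, q \in s & normc (z - q.1) < q.2.

(** Each set of a countable cover is enlarged to an open disc centered in [A], at a
    cost in radius that is summable; compactness then makes the cover finite. *)
Lemma finite_ball_cover A (e : R) : compact A -> (hausdorff_dim A < 1)%E -> 0 < e ->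
  exists s : seq (C * R), [/\ forall q, q \in s -> A q.1 /\ 0 < q.2,
    ball_cover A s & \sum_(q <- s) q.2 <= e].
Proof.
move=> cA dA e0.
have [[p Ap]|A0] := pselect (A !=set0); last first.
  exists [::]; split=> //; last by rewrite big_nil ltW.
  by move=> z Az; case: A0; exists z.
have e2 : 0 < e / 2 by rewrite divr_gt0.
have [U [rho [AU rho0 Urho srho]]] := hausdorff_dim_lt1_cover dA e2.
have /choice[x xP] : forall i, exists x, A x /\
    forall z, A z -> U i z -> U i x.
  move=> i; have [[x [Ax Ux]]|nx] := pselect (exists x, A x /\ U i x).
    by exists x.
  by exists p; split=> // z Az Uz; case: nx; exists z.
(* A set may have diameter zero: the extra term makes the radius positive, and
   the geometric weights make the total cost at most [e / 2]. *)
pose w i := rho i + e / 2 / 2 ^+ i.+1.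
have w0 i : 0 < w i by rewrite ltr_wpDl // divr_gt0 // exprn_gt0.
pose P n : set C := [set z | exists2 i, (i < n)%N & normc (z - x i) < w i].
have [n nA] : exists n, A `<=` P n.
  apply: compact_exhaust cA _ _ => [n m nm z [i ni iz]|z Az].
    by exists i => //; exact: leq_trans nm.
  have [i _ Uz] := AU z Az; have [Ax /(_ z Az Uz) Ux] := xP i.
  have zx := Urho i _ _ Uz Ux.
  exists i.+1, (e / 2 / 2 ^+ i.+1); first by rewrite divr_gt0 // exprn_gt0.
  move=> y yz; exists i => //; apply: le_lt_trans (normc_triangle z _ _) _.
  by rewrite /w addrC ler_ltD.
exists [seq (x i, w i) | i <- index_iota 0 n]; split.
- by move=> _ /mapP[i _ ->] /=; have [Ax _] := xP i.
- move=> z /nA[i ni zi]; exists (x i, w i) => //.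
  by apply/mapP; exists i; rewrite ?mem_index_iota.
- rewrite big_map /= /w big_split /=.
  have -> : \sum_(0 <= i < n) e / 2 / 2 ^+ i.+1 = e / 2 - e / 2 / 2 ^+ n.
    elim: (n) => [|k IH]; first by rewrite big_nil expr0 divr1 subrr.
    rewrite big_nat_recr //= IH exprS invfM.
    by field; rewrite expf_neq0 // pnatr_eq0.
  have := srho n; have : 0 <= e / 2 / 2 ^+ n by rewrite divr_ge0 ?exprn_ge0 // ltW.
  lra.
Qed.

(** An interval of the cover that contains the right end [b] is removed; what is left of
    [a, b] must be covered by the others. *)
Lemma interval_cover_length (s : seq (R * R)) a b :
  (forall q, q \in s -> 0 < q.2) ->
  (forall t, a <= t <= b -> exists2 q, q \in s & `|t - q.1| < q.2) ->
  b - a <= 2 * \sum_(q <- s) q.2.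
Proof.
have [n] := ubnP (size s); elim: n => // n IH in s a b * => sn s0 sab.
have sum0 u : {subset u <= s} -> 0 <= \sum_(q <- u) q.2.
  move=> us; rewrite big_seq; apply: sumr_ge0 => q /us/s0; exact: ltW.
have [ab|ba] := leP a b; last first.
  by have := sum0 s (fun _ => id); lra.
have [|q qs bq] := sab b; first by rewrite ab lexx.
rewrite (perm_big _ (perm_to_rem qs)) big_cons /=.
have q0 := s0 q qs.
move: bq; rewrite ltr_norml => /andP[bq' bq].
have : q.1 - q.2 - a <= 2 * \sum_(i <- rem q s) i.2.
  apply: IH.
  - rewrite size_rem // -ltnS; apply: leq_trans sn.
    by rewrite prednK //; case: (s) qs.
  - by move=> p /mem_rem/s0.
  - move=> t /andP[at_ tq]; have [|p ps tp] := sab t; first by rewrite at_ /=; lra.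
    exists p => //; apply: rem_mem => //; apply/eqP => pq.
    by move: tp; rewrite pq ltr_norml => /andP[]; lra.
lra.
Qed.

Lemma lipschitz_image_length A s (g : C -> R) a b :
  (forall x y, `|g x - g y| <= normc (x - y)) ->
  (forall q, q \in s -> 0 < q.2) -> ball_cover A s ->
  (forall t, a <= t <= b -> exists2 z, A z & g z = t) ->
  b - a <= 2 * \sum_(q <- s) q.2.
Proof.
move=> lg s0 As gA.
have := @interval_cover_length [seq (g q.1, q.2) | q <- s] a b.
rewrite big_map /=; apply.
  by move=> _ /mapP[q /s0 ? ->].
move=> t /gA[z /As[q qs zq] <-]; exists (g q.1, q.2).
  by apply/mapP; exists q.
by apply: le_lt_trans zq; exact: lg.
Qed.

(** The distance to [y] maps a connected set that contains [x] and [y] onto an interval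
    of length at least [|x - y|]. *)
Lemma connected_ball_cover A s x y : connected A ->
  (forall q, q \in s -> 0 < q.2) -> ball_cover A s -> A x -> A y ->
  normc (x - y) <= 2 * \sum_(q <- s) q.2.
Proof.
move=> cA s0 As Ax Ay.
pose g z := normc (z - y).
have lg u v : `|g u - g v| <= normc (u - v).
  rewrite ler_norml /g; apply/andP; split.
    by have := normc_triangle u v y; rewrite (normc_distC v u); lra.
  by have := normc_triangle v u y; lra.
have cgA : connected (g @` A).
  apply: connected_continuous_connected => //; apply: continuous_subspaceT => z.
  apply: (@continuous_comp _ _ _ (fun z : C => z - y)).
    by apply: continuousB; [exact: cvg_id|exact: cst_continuous].
  exact: normc_continuous.
have := @lipschitz_image_length A s g 0 (normc (x - y)) lg s0 As.
rewrite subr0; apply=> t t0.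
have [] // := (connected_intervalP _).1 cgA 0 (normc (x - y)) _ _ t t0.
- by exists y => //; rewrite /g subrr; exact: normc0.
- by exists x.
by move=> z Az <-; exists z.
Qed.

End SmallCovers.

(** * The filled Julia set has empty interior *)

Section JuliaFilled.
Context {R : realType}.
Local Notation C := (R[i]^o).
Variable c : C.

Lemma filled_julia_closed : closed (filled_julia c).
Proof.
by apply: compact_closed_plane; exact: (compact_filled_julia (lexx (2 + normc c))).
Qed.

Lemma filled_julia_unbounded_vertical (t y0 : R) :
  exists2 y : R, y0 <= y & ~ filled_julia c (t +i* y)%C.
Proof.
pose y := Num.max y0 (3 + normc c).
exists y; first by rewrite le_max lexx.
move=> /(filled_juliaE (lexx (2 + normc c)))/(_ 0%N); rewrite /level_set /=.
have yc : 3 + normc c <= y by rewrite le_max lexx orbT.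
have c0 := normc_ge0 c.
have : y <= Num.sqrt (t ^+ 2 + y ^+ 2).
  by rewrite -[X in X <= _]ger0_norm -?sqrtr_sqr ?ler_sqrt ?lerDr ?addr_ge0 ?sqr_ge0 //; lra.
lra.
Qed.

(** A vertical half-line starting in the filled Julia set has to leave it, and does so
    through its boundary. *)
Lemma julia_meets_vertical (t y0 : R) : filled_julia c (t +i* y0)%C ->
  exists y : R, julia c (t +i* y)%C.
Proof.
move=> Kz; have [y1 y01 nK] := filled_julia_unbounded_vertical t y0.
pose v (y : R) : C := (t +i* y)%C.
have cv : continuous v.
  move=> y A /nbhs_normcP[e e0 eA]; apply/nbhs_ballP; exists e => // y'.
  rewrite /ball /= distrC => yy; apply: eA; rewrite /v; simpc => /=.
  by rewrite expr0n add0r sqrtr_sqr.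
apply: contrapT => nJ; apply: nK.
have cK := filled_julia_closed.
suff /(_ (v y1)) : v @` `[y0, y1]%classic `<=` filled_julia c.
  by apply; exists y1 => //=; rewrite in_itv /= lexx andbT.
apply: (@connected_closed_cover _ _ _ (~` (interior (filled_julia c)))) => //.
- apply: connected_continuous_connected; first exact: segment_connected.
  exact: continuous_subspaceT.
- by apply: open_closedC; exact: open_interior.
- by move=> z _; have [/interior_subset|] := pselect (interior (filled_julia c) z); [left|right].
- move=> _ [y _ <-] Ky nIy; apply: nJ; exists y; split=> //.
  exact: subset_closure.
- exists (v y0); split=> //; exists y0 => //=.
  by rewrite in_itv /= lexx.
Qed.

Hypothesis dim_lt1 : (hausdorff_dim (julia c) < 1)%E.

Lemma compact_julia : compact (julia c).
Proof.
have cK := filled_julia_closed.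
apply: (@subclosed_compact _ _ (filled_julia c)).
- rewrite /julia setDE -(closure_id _).1 //; apply: closedI => //.
  by apply: open_closedC; exact: open_interior.
- exact: (compact_filled_julia (lexx (2 + normc c))).
- by rewrite /julia -(closure_id _).1 // => z [].
Qed.

(** A disc inside the filled Julia set would force the Julia set to project onto an
    interval, which discs of small total radius cannot cover. *)
Lemma julia_filled : julia c = filled_julia c.
Proof.
have cK := filled_julia_closed.
rewrite /julia -(closure_id _).1 //.
apply/seteqP; split=> [z []//|z Kz]; split=> // /nbhs_normcP[e e0 eK].
(* The projection has length [e], and twice a total radius of [e / 8] is less. *)
have e8 : 0 < e / 8 by lra.
have [s [s0 Js sume]] := finite_ball_cover compact_julia dim_lt1 e8.
have := @lipschitz_image_length _ (julia c) s (@complex.Re R)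
  (complex.Re z - e / 2) (complex.Re z + e / 2).
have ReL x y : `|complex.Re x - complex.Re y| <= normc (x - y : C).
  rewrite -raddfB; case: (x - y) => a b /=.
  by rewrite -sqrtr_sqr ler_sqrt ?lerDl ?sqr_ge0 // addr_ge0 ?sqr_ge0.
move=> /(_ ReL (fun q qs => (s0 q qs).2) Js).
suff H t : complex.Re z - e / 2 <= t <= complex.Re z + e / 2 ->
    exists2 w, julia c w & complex.Re w = t by move=> /(_ H); lra.
move=> /andP[t1 t2].
have [|y Jy] := @julia_meets_vertical t (complex.Im z); last by exists (t +i* y)%C.
apply: eK; case: z {Kz} t1 t2 => x y /= t1 t2; simpc => /=.
rewrite ?subrr ?expr0n ?addr0 sqrtr_sqr ltr_norml; apply/andP; split; lra.
Qed.


End JuliaFilled.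

(** * Contraction of the inverse branches *)

Section Contraction.
Context {R : realType}.
Local Notation C := (R[i]^o).
Variables (c : C) (T : bool -> C -> C) (N : nat) (r : R).
Local Notation f := (quad c).
Local Notation E := (level_set c N r).
Local Notation K := (filled_julia c).
Hypothesis rc : 2 + normc c < r.
Hypothesis E0 : E 0.
Hypothesis nEc : ~ E c.
Hypothesis T_right_inv : forall b z, E z -> f (T b z) = z.
Hypothesis T_continuous : forall b, {within E, continuous T b}.

(** The letters are indexed by bits as in [word_act]; a single function of the bit makes
    statements about both branches uniform. *)
Definition act (w : seq bool) (z : C) : C := foldr T z w.

Lemma act_cat u v z : act (u ++ v) z = act u (act v z).
Proof. exact: foldr_cat. Qed.

Let rc' : 2 + normc c <= r := ltW rc.

Lemma julia_sub_level : K `<=` E.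
Proof. by move=> z /(filled_juliaE rc'). Qed.

Lemma branch_level b z : E z -> E (T b z).
Proof.
move=> Ez; apply: (sub_level_set rc' (leqnSn N)).
by rewrite level_setSr T_right_inv.
Qed.

Lemma act_level w z : E z -> E (act w z).
Proof. by move=> Ez; elim: w => //= b w; exact: branch_level. Qed.

Lemma act_julia w z : K z -> K (act w z).
Proof.
move=> Kz; elim: w => //= b w Kw; apply: (filled_julia_preimage rc').
by rewrite T_right_inv //; exact: julia_sub_level.
Qed.

Lemma iter_act w z : E z -> iter (size w) f (act w z) = z.
Proof.
by move=> Ez; elim: w => // b w IH; rewrite [size _]/= iterSr /= T_right_inv //; exact: act_level.
Qed.

Lemma iter_act_drop w k z : (k <= size w)%N -> E z ->
  iter k f (act w z) = act (drop k w) z.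
Proof.
move=> kw Ez; rewrite -[in LHS](cat_take_drop k w) act_cat.
have {1}<- : size (take k w) = k by exact: size_takel.
by rewrite iter_act //; exact: act_level.
Qed.

Lemma branch_neq0 b z : E z -> T b z != 0.
Proof.
move=> Ez; apply/eqP => Tz; apply: nEc.
by have := T_right_inv b Ez; rewrite Tz quad0 => cz; rewrite -cz in Ez.
Qed.

(** [T b x] and [- T b y] are values of different branches. *)
Lemma branchD_neq0 b x y : E x -> E y -> T b x + T b y != 0.
Proof.
move=> Ex Ey; apply/eqP => /addr0_eq Txy.
have xy : x = y by rewrite -(T_right_inv b Ex) -(T_right_inv b Ey) -Txy quadN.
have /eqP := branch_neq0 b Ex; apply.
move: Txy; rewrite -xy => /eqP.
by rewrite eq_sym -addr_eq0 -mulr2n mulrn_eq0 => /eqP.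
Qed.

(** Both properties are proved letter by letter, so that only the continuity of a single
    branch on [E] is used. *)
Lemma act_image_compact_connected w :
  compact (act w @` E) /\ connected (act w @` E).
Proof.
elim: w => [|b w [kw cw]].
  have -> : act [::] @` E = E by apply/seteqP; split=> [_ [z Ez <-]//|z Ez]; exists z.
  by split; [exact: compact_level_set|exact: connected_level_set].
have -> : act (b :: w) @` E = T b @` (act w @` E).
  apply/seteqP; split=> [_ [z Ez <-]|_ [_ [z Ez <-] <-]]; last by exists z.
  by exists (act w z) => //; exists z.
have cT : {within act w @` E, continuous T b}.
  have sE : act w @` E `<=` E by move=> _ [z Ez <-]; exact: act_level.
  exact: (continuous_subspaceW sE (@T_continuous b)).
by split; [exact: continuous_compact|exact: connected_continuous_connected].
Qed.

Lemma act_image_level w : act w @` E `<=` level_set c (size w) r.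
Proof.
move=> _ [z Ez <-]; rewrite /level_set /= iter_act //.
exact: (sub_level_set rc' (leq0n N)) Ez.
Qed.

Section UniformlySmall.
Hypothesis dim_lt1 : (hausdorff_dim (julia c) < 1)%E.

(** For long words the connected sets [w(E)] lie in any given neighborhood of [K], in
    particular in a union of discs of small total radius. *)
Lemma act_uniformly_small (e : R) : 0 < e -> exists n : nat,
  forall w x y, (n <= size w)%N -> E x -> E y -> normc (act w x - act w y) <= e.
Proof.
move=> e0; have e2 : 0 < e / 2 by lra.
have [s [s0 Js sume]] := finite_ball_cover (@compact_julia _ c) dim_lt1 e2.
pose V : set C := [set z | exists2 q, q \in s & normc (z - q.1) < q.2].
have oV : open V.
  rewrite openE => z [q qs zq]; apply/nbhs_normcP.
  exists (q.2 - normc (z - q.1)); first by rewrite subr_gt0.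
  move=> y yz; exists q => //; apply: le_lt_trans (normc_triangle z _ _) _; lra.
have KV : K `<=` V by rewrite -julia_filled // => z /Js.
have [n nV] := level_set_in_open rc' oV KV.
exists n => w x y nw Ex Ey.
have [_ cw] := act_image_compact_connected w.
have := @connected_ball_cover _ _ s (act w x) (act w y) cw (fun q qs => (s0 q qs).2).
have wV : ball_cover (act w @` E) s.
  by move=> z /act_image_level/(sub_level_set rc' nw)/nV.
move=> /(_ wV); have ex z : E z -> (act w @` E) (act w z) by exists z.
by move=> /(_ (ex _ Ex) (ex _ Ey)); lra.
Qed.

End UniformlySmall.

(** A branch is a local section of [f], hence a local inverse: for [u] near [T b X],
    continuity forces [T b (f u)] to be [u] rather than [- u], since the two are far
    apart. *)
Lemma act_image_nbhs w z : normc (iter N f z) < r ->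
  nbhs (act w z) (act w @` E).
Proof.
move=> zr; have Ez : E z by exact: ltW.
elim: w => [|b w IH].
  have := @iter_quad_continuous _ c N z.
  move=> /(_ [set u | normc u < r]) cN.
  have : nbhs (iter N f z) [set u : C | normc u < r].
    apply/nbhs_normcP; exists (r - normc (iter N f z)); first by rewrite subr_gt0.
    by move=> y; have := lerB_normc y (iter N f z); rewrite /=; lra.
  move=> /cN; rewrite nbhs_simpl /= => h; apply: filterS h => y yr.
  by exists y => //; exact: ltW.
have Ewz := act_level w Ez.
have Tn0 : 0 < normc (act (b :: w) z) by rewrite normc_gt0; exact: branch_neq0.
set X := act w z in IH Ewz; have -> : act (b :: w) z = T b X by [].
have fTX : nbhs (T b X) (f @^-1` (act w @` E)).
  by apply: quad_continuous; rewrite T_right_inv.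
have [d d0 dT] := within_continuous_normcP (@T_continuous b) Ewz Tn0.
have fTd : nbhs (T b X) (f @^-1` [set u | normc (u - X) < d]).
  apply: quad_continuous; rewrite T_right_inv //; apply/nbhs_normcP.
  by exists d.
have nT : nbhs (T b X) [set u | normc (u - T b X) < normc (act (b :: w) z)].
  by apply/nbhs_normcP; exists (normc (act (b :: w) z)).
(* Suppose [T b (f u) = - u]. Then both [u] and [- u] are closer to [T b X] than its
   modulus, while their distances to it add up to at least twice that modulus. *)
near=> u.
have [y Ey yu] : (act w @` E) (f u) by near: u.
have fud : normc (f u - X) < d by near: u.
have uT : normc (u - T b X) < normc (T b X) by near: u.
have Efu : E (f u) by rewrite -yu; exact: act_level.
have := dT _ Efu fud; have /quad_eq[<- _|Tfu] := T_right_inv b Efu.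
  by exists y; rewrite //= yu.
rewrite Tfu -opprD normc_opp -[normc (act _ _)]/(normc (T b X)) => uT'.
suff : normc (T b X *+ 2) < normc (T b X) *+ 2 by rewrite normcMn ltxx.
rewrite mulr2n [X in _ < X]mulr2n.
have -> : T b X + T b X = (u + T b X) - (u - T b X) by ring.
by apply: le_lt_trans (ler_normcB _ _) _; exact: ltrD.
Unshelve. all: by end_near. Qed.

Fixpoint iter_quad_poly n : {poly R[i]} :=
  if n is k.+1 then iter_quad_poly k ^+ 2 + c%:P else 'X.

Lemma iter_quad_polyE n z : (iter_quad_poly n).[z] = iter n f z.
Proof.
by elim: n => [|n IH] /=; rewrite ?hornerX // !hornerE IH.
Qed.

(** As a polynomial in [z], this is the quotient of [f^n(z) - f^n(a)] by [z - a],
    factored through [f z - f a = (z - a) (z + a)]. *)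
Definition diff_quotient_poly n (a : C) : {poly R[i]} :=
  \prod_(k < n) (iter_quad_poly k + (iter k f a)%:P).

Lemma diff_quotient_polyE n a z :
  (diff_quotient_poly n a).[z] * (z - a) = iter n f z - iter n f a.
Proof.
elim: n => [|n IH]; first by rewrite /diff_quotient_poly big_ord0 hornerC mul1r.
rewrite /diff_quotient_poly big_ord_recr /= hornerM mulrAC.
move: IH; rewrite /diff_quotient_poly => ->.
by rewrite !hornerE iter_quad_polyE quadB.
Qed.

Lemma diff_quotient_poly_neq0 w x y : E x -> E y ->
  (diff_quotient_poly (size w) (act w y)).[act w x] != 0.
Proof.
move=> Ex Ey; rewrite /diff_quotient_poly horner_prod.
apply/prodf_neq0 => k _; rewrite hornerD iter_quad_polyE hornerC.
rewrite !iter_act_drop ?(ltnW (ltn_ord k)) //; have kw := ltn_ord k.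
rewrite (drop_nth false kw) /=.
by apply: branchD_neq0; exact: act_level.
Qed.

Lemma julia_boundary_dist : exists2 d : R, 0 < d &
  forall x y, K x -> r <= normc (iter N f y) -> d <= normc (x - y).
Proof.
apply: (@compact_closed_dist _ K [set y | r <= normc (iter N f y)]).
- exact: compact_filled_julia (lexx _).
- apply: (@preimage_closed _ _ (fun z => normc (iter N f z)) [set x | r <= x]).
    move=> x _; apply: (@continuous_comp _ _ _ (iter N f)).
      exact: iter_quad_continuous.
    exact: normc_continuous.
  exact: closed_ge.
- move=> x /(filled_juliaE (lexx _))/(_ N); rewrite /level_set /= => xN.
  by apply/negP; rewrite -ltNge; exact: le_lt_trans rc.
Qed.

(** A Schwarz lemma. The quotient of [w x - w y] by [x - y] obeys the maximum
    principle in [x]. Read at the point [w x], its reciprocal is a polynomial without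
    zeros on [w(E)], so the principle amounts to the absence of local minima. On the
    boundary of [E] the quotient is at most [M / d]. *)
Lemma act_lipschitz_diam (d M : R) w : w != [::] ->
  (forall x y, K x -> r <= normc (iter N f y) -> d <= normc (x - y)) ->
  (forall x y, E x -> E y -> normc (act w x - act w y) <= M) ->
  forall x y, E x -> K y -> d * normc (act w x - act w y) <= M * normc (x - y).
Proof.
move=> w0 dK wM x y Ex Ky; have Ey := julia_sub_level Ky.
rewrite leNgt; apply/negP => H.
pose q := diff_quotient_poly (size w) (act w y).
have qE z : E z -> normc q.[act w z] * normc (act w z - act w y) = normc (z - y).
  by move=> Ez; rewrite -normcM diff_quotient_polyE !iter_act.
have M0 : 0 <= M by apply: le_trans (wM x y Ex Ey); exact: normc_ge0.
have wxy : 0 < normc (act w x - act w y).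
  rewrite lt0r normc_ge0 andbT; apply/eqP => xy0; move: H.
  have := normc_ge0 (x - y); rewrite xy0; have := qE x Ex; rewrite xy0; nra.
have qx : normc q.[act w x] * M < d.
  by rewrite -(ltr_pM2r wxy) -mulrA [M * _]mulrC mulrA qE // mulrC.
have [kw _] := act_image_compact_connected w.
have [|_ [z Ez <-] zmin] := @normc_poly_min _ q (act w @` E) _ kw.
  by exists (act w x); exists x.
have qz : normc q.[act w z] * M < d.
  apply: le_lt_trans qx; apply: ler_wpM2r => //; apply: zmin; by exists x.
have [zr|zr] := ltP (normc (iter N f z)) r; last first.
  have := dK _ _ Ky zr; rewrite normc_distC -qE //.
  have := ler_wpM2l (normc_ge0 (q.[act w z] : C)) (wM z y Ez Ey); lra.
have /nbhs_normcP[e e0 eE] := act_image_nbhs w zr.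
have root_q : exists a, root q a.
  exists (- act w y); rewrite rootE /q /diff_quotient_poly horner_prod.
  case: (w) w0 => //= b u _; rewrite big_ord_recl /=.
  by rewrite hornerD hornerX hornerC addNr mul0r.
have [u uz] := poly_no_local_min (diff_quotient_poly_neq0 w Ez Ey) root_q e0.
by rewrite ltNge zmin //; exact: eE.
Qed.

Hypothesis dim_lt1 : (hausdorff_dim (julia c) < 1)%E.

(** Words of length [n] contract by one half once their images of [E] have diameter at
    most [d / 2]; longer words are cut into blocks of length [n]. *)
Lemma act_contraction : exists (n : nat) (L : R), [/\ (0 < n)%N, 0 < L &
  forall w x y, K x -> K y ->
    normc (act w x - act w y) <= L * 2^-1 ^+ (size w %/ n) * normc (x - y)].
Proof.
have [d d0 dK] := julia_boundary_dist.
have d2 : 0 < d / 2 by lra.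
have [n0 n0P] := act_uniformly_small dim_lt1 d2.
have r0 : 0 < r by apply: lt_trans rc; rewrite ltr_wpDr ?normc_ge0.
(* The summand 1 of [L] covers the empty word, which [act_lipschitz_diam] leaves out. *)
pose n := n0.+1; pose L := 1 + 2 * r / d.
have L0 : 0 < 2 * r / d by rewrite !mulr_gt0 // invr_gt0.
have lip w x y : K x -> K y -> normc (act w x - act w y) <= L * normc (x - y).
  move=> Kx Ky; have xy0 := normc_ge0 (x - y).
  have [->|w0] := eqVneq w [::]; first by rewrite /L /= mulrDl mul1r lerDl mulr_ge0 // ltW.
  have := @act_lipschitz_diam d (2 * r) w w0 dK.
  have wr a b : E a -> E b -> normc (act w a - act w b) <= 2 * r.
    move=> /(act_level w)/(sub_level_set rc' (leq0n N)) a0.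
    move=> /(act_level w)/(sub_level_set rc' (leq0n N)) b0.
    apply: le_trans (ler_normcB _ _) _; move: a0 b0; rewrite /level_set /=; lra.
  move=> /(_ wr x y (julia_sub_level Kx) Ky) H.
  apply: (@le_trans _ _ (2 * r / d * normc (x - y))); last first.
    by apply: ler_wpM2r => //; rewrite /L lerDr.
  by rewrite mulrAC ler_pdivlMr // mulrC.
have half w x y : size w = n -> K x -> K y ->
    normc (act w x - act w y) <= 2^-1 * normc (x - y).
  move=> wn Kx Ky; have w0 : w != [::] by case: (w) wn.
  have := @act_lipschitz_diam d (d / 2) w w0 dK.
  have wr a b : E a -> E b -> normc (act w a - act w b) <= d / 2.
    by apply: n0P; rewrite wn.
  move=> /(_ wr x y (julia_sub_level Kx) Ky).
  by rewrite -mulrA ler_pM2l.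
exists n, L; split=> //; first by rewrite /L; lra.
move=> w x y Kx Ky; have [m] := ubnP (size w); elim: m w => // m IH w wm.
have [wn|nw] := ltnP (size w) n.
  by rewrite divn_small // expr0 mulr1; exact: lip.
rewrite -{1 2}(cat_take_drop n w) !act_cat.
have tn : size (take n w) = n by rewrite size_takel.
apply: le_trans (half _ _ _ tn (act_julia _ Kx) (act_julia _ Ky)) _.
have /IH : (size (drop n w) < m)%N by rewrite size_drop; lia.
rewrite size_drop; have -> : (size w %/ n = ((size w - n) %/ n).+1)%N.
  by rewrite -{1}(subnK nw) divnDr // divnn addn1.
by rewrite exprS; set A := 2^-1 ^+ _; nra.
Qed.

End Contraction.

(** * Words of a given length *)

Section Words.

Fixpoint words (n : nat) : seq (seq bool) :=
  if n is k.+1 then map (cons false) (words k) ++ map (cons true) (words k)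
  else [:: [::]].

Lemma mem_words n w : (w \in words n) = (size w == n).
Proof.
elim: n w => [|n IH] [|b w] //=; rewrite mem_cat.
  by apply/negP => /orP[] /mapP[].
have mem_cons b' s : (b :: w \in map (cons b') s) = (b == b') && (w \in s).
  by apply/mapP/andP => [[u us [-> ->]]|[/eqP-> ws]]; [|exists w].
by rewrite !mem_cons IH eqSS; case: (b) => //=; rewrite orbF.
Qed.

Lemma words_uniq n : uniq (words n).
Proof.
elim: n => //= n IH; have inj b : injective (cons b : seq bool -> seq bool).
  by move=> ? ? [].
rewrite cat_uniq !map_inj_uniq // IH /= andbT.
by apply/hasPn => _ /mapP[w _ ->]; apply/negP => /mapP[].
Qed.

Lemma big_words_prefix (V : nmodType) (F : seq bool -> V) w n :
  \sum_(u <- words (size w + n) | prefix w u) F u =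
  \sum_(v <- words n) F (w ++ v).
Proof.
elim: w F => [|b w IH] F /=; first by apply: eq_bigl => u; rewrite prefix0s.
rewrite big_cat !big_map /=.
by case: b => /=; rewrite -(IH (fun u => F (_ :: u))) big_pred0_eq ?addr0 ?add0r.
Qed.

(** [words] grows at the front, whereas the telescoping appends a letter at the end. *)
Lemma big_words_rcons (V : nmodType) (F : seq bool -> V) n :
  \sum_(u <- words n.+1) F u =
  \sum_(u <- words n) (F (rcons u false) + F (rcons u true)).
Proof.
elim: n F => [|n IH] F; first by rewrite /= !big_cons !big_nil !addr0.
rewrite [words n.+2]/= big_cat !big_map /= -/(words n.+1).
rewrite (IH (fun u => F (false :: u))) (IH (fun u => F (true :: u))).
by rewrite [words n.+1]/= big_cat !big_map.
Qed.

End Words.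

(** * Distortion and the sum of all gaps *)

Section Distortion.
Context {R : realType}.
Local Notation C := (R[i]^o).
Variables (c : C) (T : bool -> C -> C) (K : set C).
Local Notation f := (quad c).
Local Notation act := (act T).
Hypothesis T_K : forall b z, K z -> K (T b z).
Hypothesis K_T : forall z, K z -> exists b, exists2 x, K x & z = T b x.
Hypothesis T_right_inv : forall b z, K z -> f (T b z) = z.
Variable d1 : R.
Hypothesis d1_gt0 : 0 < d1.
Hypothesis branchD_ge : forall b x y, K x -> K y -> d1 <= normc (T b x + T b y).
Hypothesis branchB_ge : forall x y, K x -> K y ->
  d1 <= normc (T true x - T false y).
Variable r : R.
Hypothesis K_bounded : forall z, K z -> normc z <= r.
Variables (n0 : nat) (L : R).
Hypothesis n0_gt0 : (0 < n0)%N.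
Hypothesis L_gt0 : 0 < L.
Hypothesis contraction : forall w x y, K x -> K y ->
  normc (act w x - act w y) <= L * 2^-1 ^+ (size w %/ n0) * normc (x - y).

Let act_K w z : K z -> K (act w z).
Proof. by move=> Kz; elim: w => //= b w; exact: T_K. Qed.

Let e (k : nat) : R := 2^-1 ^+ (k %/ n0).

Let e_ge0 k : 0 <= e k.
Proof. by rewrite exprn_ge0 // invr_ge0. Qed.

Let sum_e N : \sum_(0 <= k < N) e k <= 2 * n0%:R.
Proof.
have h : \sum_(0 <= k < N) e k <= \sum_(0 <= k < n0 + N) e k.
  rewrite [X in _ <= X](big_cat_nat (n := N)) ?leq_addl //= lerDl.
  exact: sumr_ge0.
have h2 : \sum_(0 <= k < n0) e k = n0%:R.
  rewrite (eq_big_nat _ _ (F2 := fun=> 1)).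
    by rewrite sumr_const_nat subn0.
  by move=> k /andP[_ kn]; rewrite /e divn_small.
(* [e] is halved by a shift of [n0], so its sum is at most [n0] plus half of itself. *)
have h3 : \sum_(n0 <= k < n0 + N) e k = 2^-1 * \sum_(0 <= k < N) e k.
  rewrite -{1}[n0]add0n [(n0 + N)%N]addnC big_addn addnK mulr_sumr.
  apply: eq_bigr => k _; rewrite /e divnDr // divnn n0_gt0 addn1.
  by rewrite exprS.
move: h; rewrite [X in _ <= X](big_cat_nat (n := n0)) ?leq_addr //= h2 h3; lra.
Qed.

(** Prefixing a letter divides [x - y] by [T x + T y]. Replacing [x, y] by [x', y']
    changes the divisor by a relative amount of the size of the current cylinder, so the
    ratio of distances is distorted by a product of factors [1 + a e k] with summable
    [e k]. *)
Lemma bounded_distortion : exists2 D : R, 0 < D &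
  forall w x y x' y', K x -> K y -> K x' -> K y' ->
  normc (act w x - act w y) * normc (x' - y') <=
  D * (normc (act w x' - act w y') * normc (x - y)).
Proof.
(* [T x + T y] moves by at most [2 * (L e) * (2 r)], to be compared with [d1]. *)
pose a := 4 * r * L / d1.
have r0 x : K x -> 0 <= r.
  by move=> /K_bounded; apply: le_trans; exact: normc_ge0.
pose P n := expR (a * \sum_(0 <= k < n) e k.+1).
exists (expR (`|a| * (2 * n0%:R))); first exact: expR_gt0.
move=> w x y x' y' Kx Ky Kx' Ky'.
have a0 : 0 <= a.
  apply: divr_ge0; last exact: ltW.
  by apply: mulr_ge0; [apply: mulr_ge0 => //; exact: r0 Kx|exact: ltW].
apply: (@le_trans _ _ (P (size w) *
    (normc (act w x' - act w y') * normc (x - y)))); last first.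
  apply: ler_wpM2r; first by rewrite mulr_ge0 ?normc_ge0.
  rewrite ler_expR ger0_norm //; apply: ler_wpM2l => //.
  apply: le_trans (sum_e (size w).+1).
  by rewrite [X in _ <= X]big_nat_recl // lerDr.
elim: w => [|b w IH].
  by rewrite /P /= big_nil mulr0 expR0 mul1r mulrC.
have KX := act_K w Kx; have KY := act_K w Ky.
have KX' := act_K w Kx'; have KY' := act_K w Ky'.
have dE u v : K u -> K v ->
    normc (T b u - T b v) * normc (T b u + T b v) = normc (u - v).
  by move=> Ku Kv; rewrite -normcM -(@quadB _ c) !T_right_inv.
have sXY := branchD_ge b KX KY.
have s0 : 0 < normc (T b (act w x) + T b (act w y)) by exact: lt_le_trans sXY.
have near u v : K u -> K v ->
    normc (T b (act w u) - T b (act w v)) <= L * e (size w).+1 * (2 * r).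
  move=> Ku Kv; apply: le_trans (contraction (b :: w) Ku Kv) _.
  apply: ler_wpM2l; first by rewrite mulr_ge0 // ltW.
  apply: le_trans (ler_normcB _ _) _.
  by have := K_bounded Ku; have := K_bounded Kv; lra.
have ratio : normc (T b (act w x') + T b (act w y')) <=
    normc (T b (act w x) + T b (act w y)) * (1 + a * e (size w).+1).
  have -> : T b (act w x') + T b (act w y') =
    (T b (act w x) + T b (act w y)) +
    ((T b (act w x') - T b (act w x)) + (T b (act w y') - T b (act w y))).
    by ring.
  apply: le_trans (ler_normcD _ _) _; rewrite mulrDr mulr1 lerD2l.
  apply: le_trans (ler_normcD _ _) _.
  apply: le_trans (lerD (near _ _ Kx' Kx) (near _ _ Ky' Ky)) _.
  apply: (@le_trans _ _ (d1 * (a * e (size w).+1))); last first.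
    by apply: ler_wpM2r => //; rewrite mulr_ge0.
  rewrite /a le_eqVlt; apply/orP; left; apply/eqP.
  by field; rewrite gt_eqF.
rewrite /= -(ler_pM2r s0).
have -> : normc (T b (act w x) - T b (act w y)) * normc (x' - y') *
    normc (T b (act w x) + T b (act w y)) =
    normc (act w x - act w y) * normc (x' - y').
  by rewrite mulrAC dE.
apply: le_trans IH _; rewrite -(dE _ _ KX' KY').
have PS : P (size w) * (1 + a * e (size w).+1) <= P (size w).+1.
  rewrite /P big_nat_recr //= [in X in _ <= X]mulrDr expRD ler_pM2l ?expR_gt0 //.
  exact: expR_ge1Dx.
set t := normc (T b (act w x') - T b (act w y')).
have t0 : 0 <= t * normc (x - y) by rewrite mulr_ge0 ?normc_ge0.
set q := 1 + a * e (size w).+1 in ratio PS; clearbody q.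
apply: (@le_trans _ _ (P (size w) * q * (t * normc (x - y))
     * normc (T b (act w x) + T b (act w y)))); last first.
  by apply: ler_wpM2r; [exact: ltW|exact: ler_wpM2r].
have P0 : 0 <= P (size w) by exact: expR_ge0.
rewrite -!mulrA; apply: ler_wpM2l => //.
have := ler_wpM2l t0 ratio.
set A := normc (T b (act w x') + _); set B := normc (T b (act w x) + _) => H.
have -> : t * (A * normc (x - y)) = t * normc (x - y) * A by ring.
by have -> : q * (t * (normc (x - y) * B)) = t * normc (x - y) * (B * q) by ring.
Qed.

(** The two branches have disjoint images, so a point determines its letters. *)
Lemma act_prefix u w x y : K x -> K y -> act u x = act w y ->
  (size w <= size u)%N -> prefix w u.
Proof.
move=> Kx Ky; elim: w u => [|b w IH] [|b' u] //=.
have KX := act_K u Kx; have KY := act_K w Ky.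
move=> Tuw; rewrite ltnS => wu.
have uw : act u x = act w y.
  by rewrite -(T_right_inv b' KX) Tuw T_right_inv.
rewrite IH // andbT; apply/eqP; apply: contrapT => bb'.
have TT : T true (act w y) = T false (act w y).
  by move: bb' Tuw; rewrite uw; case: (b); case: (b') => // _ ->.
by have := branchB_ge KY KY; rewrite TT subrr [normc _](normc0 R) leNgt d1_gt0.
Qed.

Variables p q : C.
Hypothesis Kp : K p.
Hypothesis Kq : K q.
Hypothesis pq : p != q.

Definition gap w : R := normc (act w p - act w q).

Lemma gap_ge0 w : 0 <= gap w.
Proof. exact: normc_ge0. Qed.

Let pq0 : 0 < normc (p - q).
Proof. by rewrite normc_gt0 subr_eq0. Qed.

(** Bounded distortion for [u], comparing the pair [v p], [v q] with [p], [q]. *)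
Lemma gap_cat : exists2 B : R, 0 < B & forall u v, gap (u ++ v) <= B * (gap u * gap v).
Proof.
have [D D0 dist] := bounded_distortion.
exists (D / normc (p - q)); first by rewrite divr_gt0.
move=> u v; rewrite /gap !act_cat mulrAC ler_pdivlMr //.
by apply: dist => //; exact: act_K.
Qed.

Lemma act_gap : exists2 B : R, 0 < B &
  forall w x y, K x -> K y -> normc (act w x - act w y) <= B * gap w.
Proof.
have [D D0 dist] := bounded_distortion.
have r0 : 0 <= r by apply: le_trans (K_bounded Kp); exact: normc_ge0.
exists (D * (2 * r + 1) / normc (p - q)).
  by rewrite divr_gt0 // mulr_gt0 //; lra.
move=> w x y Kx Ky; rewrite mulrAC ler_pdivlMr //.
apply: le_trans (dist w x y p q Kx Ky Kp Kq) _.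
rewrite -mulrA ler_pM2l // mulrC ler_wpM2r ?gap_ge0 //.
apply: le_trans (ler_normcB _ _) _.
by have := K_bounded Kx; have := K_bounded Ky; lra.
Qed.

(** Take the longest [w] whose cylinder contains [S]. Then [S] meets both
    subcylinders of [w]; these are at a distance comparable to the gap of [w], by bounded
    distortion. If there is no longest [w], any sufficiently long one will do. *)
Lemma cylinder_hull : exists2 B : R, 0 < B &
  forall (S : set C) (rho : R), S `<=` K -> 0 < rho ->
    (forall x y, S x -> S y -> normc (x - y) <= rho) ->
    exists2 w, S `<=` act w @` K & gap w <= B * rho.
Proof.
have [D D0 dist] := bounded_distortion.
pose B := D * normc (p - q) / d1.
have B0 : 0 < B by rewrite divr_gt0 // mulr_gt0.
exists B => // S rho SK rho0 Srho.
have step n : (exists2 w, size w = n & S `<=` act w @` K) \/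
    exists2 w, S `<=` act w @` K & gap w <= B * rho.
  elim: n => [|n [[w wn Sw]|]]; [left|idtac|by right].
    by exists [::] => // z /SK Kz; exists z.
  have Sb : forall z, S z -> exists b, exists2 x, K x & z = act (rcons w b) x.
    move=> z /Sw[_ /K_T[b [x Kx ->]] <-].
    by exists b, x => //; rewrite -cats1 act_cat.
  have [St|St] := pselect (S `<=` act (rcons w true) @` K).
    by left; exists (rcons w true) => //; rewrite size_rcons wn.
  have [Sf|Sf] := pselect (S `<=` act (rcons w false) @` K).
    by left; exists (rcons w false) => //; rewrite size_rcons wn.
  right; exists w => //.
  have other b : ~ S `<=` act (rcons w b) @` K ->
      exists2 x, K x & S (act w (T (~~ b) x)).
    move=> /existsNP[z /not_implyP[Sz nz]]; have [b' [x Kx zE]] := Sb z Sz.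
    exists x => //.
    have bb' : b' <> b by move=> bb'; apply: nz; exists x; rewrite ?zE ?bb'.
    have <- : b' = ~~ b by case: (b) (b') bb' => [] [].
    by move: Sz; rewrite zE -cats1 act_cat.
  have [x Kx Sx] := other _ Sf; have [y Ky Sy] := other _ St.
  have Txy := branchB_ge Kx Ky.
  have := dist w p q (T true x) (T false y) Kp Kq (T_K true Kx) (T_K false Ky).
  rewrite -/(gap w) => H.
  have {}H : gap w * d1 <= D * (rho * normc (p - q)).
    apply: le_trans (ler_wpM2l (gap_ge0 w) Txy) _; apply: le_trans H _.
    rewrite ler_pM2l // ler_pM2r //; exact: Srho.
  by rewrite /B mulrAC ler_pdivlMr // mulrAC -mulrA.
pose A := L * normc (p - q).
have A0 : 0 < A by rewrite mulr_gt0.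
have Br0 : 0 < B * rho by exact: mulr_gt0.
have [m mP] : exists m : nat, A * 2^-1 ^+ m <= B * rho.
  have M0 : 0 <= A / (B * rho) by rewrite divr_ge0 // ltW.
  exists (Num.bound (A / (B * rho))).
  rewrite exprVn ler_pdivrMr ?exprn_gt0 // -ler_pdivrMl //.
  rewrite mulrC; apply: le_trans (ltW (archi_boundP M0)) _.
  by rewrite -natrX ler_nat ltnW // ltn_expl.
have [[w wm Sw]|//] := step (m * n0)%N.
exists w => //; apply: le_trans mP.
apply: le_trans (contraction w Kp Kq) _.
by rewrite wm mulnK // /A mulrAC.
Qed.

Hypothesis K_covers : forall eps : R, 0 < eps ->
  exists s : seq (C * R), [/\ forall q, q \in s -> K q.1 /\ 0 < q.2,
    ball_cover K s & \sum_(q <- s) q.2 <= eps].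

(** Each disc of a cover of small total radius is traded for a cylinder. *)
Lemma cylinder_cover (eps : R) : 0 < eps -> exists W : seq (seq bool),
  (forall z, K z -> exists2 w, w \in W & (act w @` K) z) /\
  \sum_(w <- W) gap w <= eps.
Proof.
move=> eps0; have [B B0 hull] := cylinder_hull.
have e0 : 0 < eps / (2 * B) by rewrite divr_gt0 // mulr_gt0.
have [s [s0 Ks sum_s]] := K_covers e0.
have /choice[wf wfP] : forall a : C * R, exists w, a \in s ->
    K `&` [set z | normc (z - a.1) < a.2] `<=` act w @` K /\
    gap w <= B * (2 * a.2).
  move=> a; have [/s0[_ a0]|_] := boolP (a \in s); last by exists [::].
  have [||x y [_ xa] [_ ya]|w Sw gw] :=
    hull (K `&` [set z | normc (z - a.1) < a.2]) (2 * a.2).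
  - by move=> z [].
  - by rewrite mulr_gt0.
  - apply: le_trans (normc_triangle a.1 _ _) _.
    move: xa ya; rewrite /= (normc_distC y); lra.
  by exists w.
exists [seq wf a | a <- s]; split.
  move=> z Kz; have [a sa za] := Ks z Kz; exists (wf a).
    exact: map_f.
  by have [+ _] := wfP a sa; apply.
rewrite big_map; apply: (@le_trans _ _ (\sum_(a <- s) B * (2 * a.2))).
  by rewrite big_seq [X in _ <= X]big_seq; apply: ler_sum => a /wfP[].
rewrite -!mulr_sumr mulrA.
by move: sum_s; rewrite ler_pdivlMr ?mulr_gt0 // mulrC (mulrC 2).
Qed.

Definition level_gap n := \sum_(w <- words n) gap w.

Lemma level_gap_ge0 n : 0 <= level_gap n.
Proof. by apply: sumr_ge0 => w _; exact: gap_ge0. Qed.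

(** Every word of length [n] begins with some word [w] of [W], because its value at [p]
    lies in a cylinder of [W]; the remaining letters range over all words of length
    [n - size w]. *)
Lemma level_gap_renewal (B : R) (W : seq (seq bool)) n :
  (forall u v, gap (u ++ v) <= B * (gap u * gap v)) ->
  (forall z, K z -> exists2 w, w \in W & (act w @` K) z) ->
  (forall w, w \in W -> (size w <= n)%N) ->
  level_gap n <= \sum_(w <- W) B * gap w * level_gap (n - size w).
Proof.
move=> Bcat KW Wn.
apply: (@le_trans _ _ (\sum_(u <- words n) \sum_(w <- W | prefix w u) gap u)).
  rewrite /level_gap big_seq [X in _ <= X]big_seq.
  apply: ler_sum => u; rewrite mem_words => /eqP un.
  have [w wW [x Kx wx]] := KW _ (act_K u Kp).
  have wu : prefix w u by apply: act_prefix Kp Kx (esym wx) _; rewrite un Wn.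
  rewrite (big_rem w) //= wu lerDl.
  by apply: sumr_ge0 => ? _; exact: gap_ge0.
rewrite (exchange_big_dep predT) //= big_seq [X in _ <= X]big_seq.
apply: ler_sum => w wW; rewrite -{1}(subnKC (Wn w wW)).
rewrite (big_words_prefix gap) /level_gap mulr_sumr.
by apply: ler_sum => v _; rewrite -mulrA; exact: Bcat.
Qed.

(** [W] is chosen with total gap at most [1 / (2 B)]. Summing [level_gap_renewal] over
    all lengths from [l] to [n] bounds the partial sum by its first [l] terms plus half
    of itself. *)
Lemma sum_level_gap_bounded : exists M : R, forall n,
  \sum_(0 <= k < n) level_gap k <= M.
Proof.
have [B B0 Bcat] := gap_cat.
have e0 : 0 < (2 * B)^-1 by rewrite invr_gt0 mulr_gt0.
have [W [KW sumW]] := cylinder_cover e0.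
pose l := \max_(w <- W) size w.
have Wl w : w \in W -> (size w <= l)%N by move=> wW; exact: leq_bigmax_seq.
pose S n := \sum_(0 <= k < n) level_gap k.
have S_mono n m : (n <= m)%N -> S n <= S m.
  move=> nm; rewrite /S [X in _ <= X](big_cat_nat (n := n)) //= lerDl.
  by apply: sumr_ge0 => k _; exact: level_gap_ge0.
have S0 n : 0 <= S n by apply: sumr_ge0 => k _; exact: level_gap_ge0.
exists (2 * S l) => n; rewrite -/(S n).
have [nl|ln] := leqP n l; first by have := S_mono _ _ nl; have := S0 l; lra.
suff : S n <= S l + 2^-1 * S n by lra.
rewrite {1}/S (big_cat_nat (n := l)) ?(ltnW ln) //= lerD2l.
apply: (@le_trans _ _ (\sum_(l <= k < n)
    \sum_(w <- W) B * gap w * level_gap (k - size w))).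
  rewrite big_nat [X in _ <= X]big_nat; apply: ler_sum => k /andP[lk _].
  apply: level_gap_renewal => // w /Wl wl; exact: leq_trans lk.
rewrite exchange_big /=.
apply: (@le_trans _ _ (\sum_(w <- W) B * gap w * S n)); last first.
  rewrite -mulr_suml -mulr_sumr; apply: ler_wpM2r => //.
  have := ler_wpM2l (ltW B0) sumW; move/le_trans; apply.
  by rewrite invfM mulrCA divff ?mulr1 // gt_eqF.
rewrite big_seq [X in _ <= X]big_seq; apply: ler_sum => w /Wl wl.
rewrite -mulr_sumr; apply: ler_wpM2l; first by rewrite mulr_ge0 ?gap_ge0 ?ltW.
have -> : \sum_(l <= k < n) level_gap (k - size w) =
    \sum_(l - size w <= k < n - size w) level_gap k.
  rewrite -{1}(subnK wl) big_addn; apply: eq_bigr => k _; by rewrite addnK.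
apply: le_trans (S_mono _ _ (leq_subr (size w) n)).
rewrite /S [X in _ <= X](big_cat_nat (n := l - size w)) ?leq_sub2r ?(ltnW ln) //=.
by rewrite lerDr; exact: S0.
Qed.

End Distortion.

(** * Telescoping and convergence *)

Section SignedGaps.
Context {R : realType}.
Local Notation C := (R[i]^o).
Variables (T : bool -> C -> C) (p q : C).
Local Notation act := (act T).
Local Notation gap := (gap T p q).
Local Notation level_gap := (level_gap T p q).
Hypothesis T_false : T false p = p.
Hypothesis T_true : T true p = q.

Definition word_sign (w : seq bool) : C := (-1) ^+ count_mem true w.

Definition signed_gap (w : seq bool) : C :=
  word_sign w * (act w (T false q) - act w (T true q)).

Definition signed_level_gap n : C :=
  \sum_(w <- words n) word_sign w * (act w p - act w q).

Lemma normc_word_sign w : normc (word_sign w) = 1.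
Proof. by rewrite normcX normc_opp [normc _](normc1 R) expr1n. Qed.

(** Appending a letter to [w] splits [w p - w q] at [w (T false q)] and [w (T true q)],
    where [T false p = p] and [T true p = q]; the extra sign of [T true] turns its gap
    around. *)
Lemma signed_level_gap_rec n :
  signed_level_gap n = \sum_(w <- words n) signed_gap w + signed_level_gap n.+1.
Proof.
rewrite /signed_level_gap big_words_rcons -big_split /=.
apply: eq_bigr => w _; rewrite -!cats1 !act_cat /=.
rewrite /signed_gap /word_sign !count_cat /= !addn0 T_false T_true addn1 exprS.
ring.
Qed.

Lemma signed_gap_telescope n :
  \sum_(0 <= k < n) \sum_(w <- words k) signed_gap w = (p - q) - signed_level_gap n.
Proof.
elim: n => [|n IH].
  rewrite big_nil /signed_level_gap /= big_cons big_nil /word_sign /=.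
  by rewrite mul1r addr0 subrr.
by rewrite big_nat_recr //= IH (signed_level_gap_rec n); ring.
Qed.

Lemma normc_sum (I : Type) (s : seq I) (P : pred I) (F : I -> C) :
  normc (\sum_(i <- s | P i) F i) <= \sum_(i <- s | P i) normc (F i).
Proof.
elim/big_rec2: _ => [|i y1 y2 _ le]; first by rewrite [normc _](normc0 R).
by apply: le_trans (ler_normcD _ _) _; rewrite lerD2l.
Qed.

Lemma normc_signed_level_gap n : normc (signed_level_gap n) <= level_gap n.
Proof.
apply: le_trans (normc_sum _ _ _) _; apply: ler_sum => w _.
by rewrite normcM normc_word_sign mul1r.
Qed.

Definition words_lt n : seq (seq bool) := flatten [seq words k | k <- iota 0 n].

Lemma mem_words_lt n w : (w \in words_lt n) = (size w < n)%N.
Proof.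
apply/flattenP/idP => [[_ /mapP[k kn ->]]|wn].
  by rewrite mem_words => /eqP ->; move: kn; rewrite mem_iota.
exists (words (size w)); last by rewrite mem_words.
by apply: map_f; rewrite mem_iota.
Qed.

Lemma words_lt_uniq n : uniq (words_lt n).
Proof.
elim: n => // n IH.
rewrite /words_lt -addn1 iotaD map_cat flatten_cat /= cats0 cat_uniq.
rewrite -/(words_lt n) IH words_uniq andbT /=.
apply/hasPn => w; rewrite mem_words mem_words_lt add0n => /eqP ->.
by rewrite ltnn.
Qed.

Lemma big_words_lt (V : nmodType) (F : seq bool -> V) n :
  \sum_(w <- words_lt n) F w = \sum_(0 <= k < n) \sum_(w <- words k) F w.
Proof. by rewrite /words_lt big_flatten big_map /= /index_iota subn0. Qed.

Lemma big_uniq_split (V : nmodType) (I : eqType) (F : I -> V) (s t : seq I) :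
  uniq s -> uniq t -> {subset t <= s} ->
  \sum_(i <- s) F i = \sum_(i <- t) F i + \sum_(i <- s | i \notin t) F i.
Proof.
move=> us ut ts; rewrite (bigID (mem t)) /=; congr (_ + _).
rewrite -big_filter; apply: perm_big; apply: uniq_perm => //.
  exact: filter_uniq.
by move=> i; rewrite mem_filter; case: (boolP (i \in t)) => // /ts ->.
Qed.

Variables (B M : R).
Hypothesis B_gt0 : 0 < B.
Hypothesis signed_gap_le : forall w, normc (signed_gap w) <= B * gap w.
Hypothesis level_gap_bounded : forall n, \sum_(0 <= k < n) level_gap k <= M.

Let S n := \sum_(0 <= k < n) level_gap k.

Let level_gap0 n : 0 <= level_gap n.
Proof. by apply: sumr_ge0 => w _; exact: normc_ge0. Qed.

Let S_cauchy (e : R) : 0 < e -> exists n, forall m, (n <= m)%N -> S m - S n < e.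
Proof.
move=> e0; have S0 : has_sup (range S).
  split; first by exists (S 0), 0%N.
  by exists M => _ [n _ <-]; exact: level_gap_bounded.
have [_ [n _ <-] Sn] := sup_adherent e0 S0.
exists n => m _; have : S m <= sup (range S) by apply: sup_upper_bound => //; exists m.
lra.
Qed.

(** Partial sums over finite sets [X] that contain all words of length below [n] differ
    from the telescoped sum by two tails of the convergent series of gaps. *)
Lemma signed_gap_sum : partial_sum signed_gap @ totally --> p - q.
Proof.
move=> A /nbhs_normcP[e e0 eA].
have e1 : 0 < e / (B + 1) by rewrite divr_gt0 // ltr_wpDl // ltW.
have [n nS] := S_cauchy e1.
exists [fset w in words_lt n]%fset => // X /= nX; apply: eA.
have sub : {subset words_lt n <= X}.
  by move=> w wn; apply: (fsubsetP nX); rewrite inE.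
have uX : uniq X by exact: fset_uniq.
pose m := maxn n (\max_(w <- X) (size w).+1)%N.
have Xm : {subset X <= words_lt m}.
  move=> w wX; rewrite mem_words_lt leq_max; apply/orP; right.
  by rewrite (big_rem w) //= leq_maxl.
have nm : (n <= m)%N by rewrite leq_maxl.
rewrite /partial_sum -(big_seq_fsetE _ X xpredT signed_gap) /=.
rewrite (big_uniq_split signed_gap uX (words_lt_uniq n) sub).
rewrite big_words_lt signed_gap_telescope.
set tail := \sum_(_ <- _ | _) _.
have -> : p - q - signed_level_gap n + tail - (p - q) = tail - signed_level_gap n.
  ring.
have Stail : \sum_(w <- X | w \notin words_lt n) gap w <= S m - S n.
  have h := big_uniq_split gap uX (words_lt_uniq n) sub.
  have h' := big_uniq_split gap (words_lt_uniq m) uX Xm.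
  move: h'; rewrite h !big_words_lt -!/(level_gap _) -/(S n) -/(S m) => ->.
  rewrite addrC -addrA addKr lerDl.
  by apply: sumr_ge0 => w _; exact: normc_ge0.
apply: le_lt_trans (ler_normcB _ _) _.
have tail_le : normc tail <= B * (e / (B + 1)).
  apply: le_trans (normc_sum _ _ _) _.
  apply: (@le_trans _ _ (\sum_(w <- X | w \notin words_lt n) B * gap w)).
    by apply: ler_sum => w _; exact: signed_gap_le.
  rewrite -mulr_sumr ler_pM2l //; apply: le_trans Stail _.
  exact/ltW/nS.
have lev_lt : normc (signed_level_gap n) < e / (B + 1).
  apply: le_lt_trans (normc_signed_level_gap n) _.
  have := nS n.+1 (leqnSn n); rewrite /S big_nat_recr //=.
  by rewrite addrAC subrr add0r.
have -> : e = B * (e / (B + 1)) + e / (B + 1).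
  by field; rewrite gt_eqF // ltr_wpDl // ltW.
exact: ler_ltD.
Qed.

End SignedGaps.

(** * The gap formula *)

Section Assembly.
Context {R : realType}.
Local Notation C := (R[i]^o).

Lemma filled_julia_image (c z : C) : filled_julia c z -> filled_julia c (quad c z).
Proof.
move=> [M zM]; exists M => n; rewrite -iterSr; exact: zM.
Qed.

Lemma word_act_act (T1 T2 : C -> C) w z :
  word_act T1 T2 w z = act (fun b => if b then T2 else T1) w z.
Proof. by elim: w => //= b w ->; case: b. Qed.

End Assembly.

Theorem theorem4p4 (R : realType) (c : R[i]^o)
    (c_notin_M : ~ mandelbrot c)
    (dim_lt1 : (hausdorff_dim (julia c) < 1)%E)
    (s : R) (s_range : green c 0 < s < green c c)
    (T1 T2 : R[i]^o -> R[i]^o)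
    (T1_branch : inverse_branch c (green_disk c s) T1)
    (T2_branch : inverse_branch c (green_disk c s) T2)
    (T2_opp : forall z, green_disk c s z -> T2 z = - T1 z)
    (z1 : R[i]^o) (z1_julia : julia c z1) (z1_fixed : T1 z1 = z1) :
  partial_sum (fun w : seq bool =>
      (-1) ^+ count_mem true w
        * (word_act T1 T2 w (T1 (- z1)) - word_act T1 T2 w (T2 (- z1))))
    @ totally --> z1 - (- z1).
Proof.
have [G0s Gcs] := andP s_range.
have [N [r [rc E0 ED]]] := level_set_in_green_disk G0s.
have rc' := ltW rc.
set E := level_set c N r in E0 ED.
have nEc : ~ E c by move=> /ED; rewrite /green_disk /= leNgt Gcs.
pose T b := if b then T2 else T1.
have T_right_inv b z : E z -> quad c (T b z) = z.
  move=> /ED Dz; case: T1_branch => _ _ T1K; case: T2_branch => _ _ T2K.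
  by case: b; [exact: T2K|exact: T1K].
have T_continuous b : {within E, continuous T b}.
  apply: (continuous_subspaceW ED).
  by case: T1_branch => cT1 _ _; case: T2_branch => cT2 _ _; case: b.
have TN z : E z -> T true z = - T false z by move=> /ED; exact: T2_opp.
have KE : filled_julia c `<=` E by apply: julia_sub_level.
have T_K b z : filled_julia c z -> filled_julia c (T b z).
  exact: (act_julia rc T_right_inv [:: b]).
have K_T z : filled_julia c z -> exists b, exists2 x, filled_julia c x & z = T b x.
  move=> Kz; have Kfz := filled_julia_image Kz; have Efz := KE _ Kfz.
  have [zE|zE] := quad_eq (T_right_inv false _ Efz).
    by exists false, (quad c z).
  by exists true, (quad c z) => //; rewrite TN // zE opprK.
have [d1 d1_gt0 dP] : exists2 d : R, 0 < d & forall x y,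
    (T true @` E) x -> (T false @` E) y -> d <= normc (x - y).
  have kE : compact E by exact: compact_level_set.
  apply: compact_closed_dist.
  - exact: continuous_compact.
  - by apply: compact_closed_plane; exact: continuous_compact.
  - move=> _ [x Ex <-] [y Ey Txy].
    have xy : x = y by rewrite -(T_right_inv true _ Ex) -Txy T_right_inv.
    have /eqP := branchD_neq0 nEc T_right_inv true Ex Ex; apply.
    by rewrite {1}TN // -Txy -xy addNr.
have branchB_ge x y : filled_julia c x -> filled_julia c y ->
    d1 <= normc (T true x - T false y).
  by move=> /KE Ex /KE Ey; apply: dP; [exists x|exists y].
have branchD_ge b x y : filled_julia c x -> filled_julia c y ->
    d1 <= normc (T b x + T b y).
  move=> Kx Ky; case: b.
    by rewrite (TN y (KE _ Ky)); exact: branchB_ge.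
  have -> : T false x + T false y = - (T true x - T false y).
    by rewrite (TN x (KE _ Kx)) opprD !opprK.
  by rewrite normc_opp; exact: branchB_ge.
have K_bounded z : filled_julia c z -> normc z <= r.
  by move=> /(filled_juliaE rc')/(_ 0%N).
have [n0 [L [n0_gt0 L_gt0 contraction]]] :=
  act_contraction rc E0 nEc T_right_inv T_continuous dim_lt1.
have T_right_inv' b z : filled_julia c z -> quad c (T b z) = z.
  by move=> /KE; exact: T_right_inv.
have K_covers (e : R) : 0 < e -> exists u : seq (R[i]^o * R),
    [/\ forall q, q \in u -> filled_julia c q.1 /\ 0 < q.2,
        ball_cover (filled_julia c) u & \sum_(q <- u) q.2 <= e].
  rewrite -julia_filled //; apply: finite_ball_cover => //; exact: compact_julia.
have Kz1 : filled_julia c z1 by rewrite -julia_filled.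
have fz1 : quad c z1 = z1.
  have := T_right_inv false _ (KE _ Kz1).
  by rewrite /T z1_fixed.
have KNz1 : filled_julia c (- z1).
  by apply: (filled_julia_preimage rc'); rewrite quadN fz1.
have z1N : z1 != - z1.
  have := branchD_neq0 nEc T_right_inv false (KE _ Kz1) (KE _ Kz1).
  by rewrite /T z1_fixed -addr_eq0.
have T_true : T true z1 = - z1 by rewrite (TN _ (KE _ Kz1)) /T z1_fixed.
have [B B0 gapB] := act_gap T_K T_right_inv' d1_gt0 branchD_ge K_bounded n0_gt0
  L_gt0 contraction Kz1 KNz1 z1N.
have [M boundM] := sum_level_gap_bounded T_K K_T T_right_inv' d1_gt0 branchD_ge
  branchB_ge K_bounded n0_gt0 L_gt0 contraction Kz1 KNz1 z1N K_covers.
have gap_le w : normc (signed_gap T (- z1) w) <= B * gap T z1 (- z1) w.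
  by rewrite /signed_gap normcM normc_word_sign mul1r; apply: gapB; exact: T_K.
rewrite (_ : (fun w : seq bool => _) = signed_gap T (- z1)).
  exact: (signed_gap_sum z1_fixed T_true B0 gap_le boundM).
by apply/funext => w; rewrite /signed_gap /word_sign !word_act_act.
Qed.
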